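(* Let $p,q\ge 0$ be integers with $n=p+q\ge 1$. Consider the subsets (Lie groups) of $\mathbb{C}\otimes C\!\ell_{p,q}$ \[ G^{2i1}_{p,q}=\{U\in C\!\ell^{(0)}_{p,q}\oplus iC\!\ell^{(1)}_{p,q}: U^\ddagger U=e\},\quad G^{2i3}_{p,q}=\{U\in C\!\ell^{(0)}_{p,q}\oplus iC\!\ell^{(1)}_{p,q}: \hat U^{\ddagger} U=e\}, \] \[ G^{23}_{p,q}=\{U\in C\!\ell_{p,q}: \tilde U U=e\},\quad G^{12}_{p,q}=\{U\in C\!\ell_{p,q}: \tilde{\hat U} U=e\},\quad G^{2}_{p,q}=\{U\in C\!\ell^{(0)}_{p,q}: \tilde U U=e\}. \] Then the following Lie group isomorphisms hold (here $H\oplus H$ denotes the direct product of two copies of the group $H$). (i) If $p-q\equiv 4,5,6\pmod 8$: $G^{23}_{p,q}\cong\mathrm{Sp}(2^{\frac{n-2}{2}})$ if $(p,q)=(n,0)$ with $n$ even; $\cong\mathrm{Sp}(2^{\frac{n-4}{2}},2^{\frac{n-4}{2}})$ if $n\equiv 4,6\pmod 8$ and $q\ne0$; $\cong \mathrm{O}(2^{\frac{n-2}{2}},\mathbb{H})$ if $n\equiv 0,2\pmod 8$; $\cong\mathrm{Sp}(2^{\frac{n-3}{2}})\oplus\mathrm{Sp}(2^{\frac{n-3}{2}})$ if $(p,q)=(n,0)$ with $n$ odd; $\cong \mathrm{Sp}(2^{\frac{n-5}{2}},2^{\frac{n-5}{2}})\oplus \mathrm{Sp}(2^{\frac{n-5}{2}},2^{\frac{n-5}{2}})$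 if $n\equiv 5\pmod 8$ and $q\ne 0$; $\cong\mathrm{O}(2^{\frac{n-3}{2}},\mathbb{H})\oplus\mathrm{O}(2^{\frac{n-3}{2}},\mathbb{H})$ if $n\equiv 1\pmod 8$; $\cong \mathrm{GL}(2^{\frac{n-3}{2}},\mathbb{H})$ if $n\equiv 3,7\pmod 8$. (ii) If $p-q\equiv 4,5,6\pmod 8$: $G^{12}_{p,q}\cong\mathrm{Sp}(2^{\frac{n-2}{2}})$ if $(p,q)=(0,n)$ with $n$ even; $\cong\mathrm{Sp}(2^{\frac{n-4}{2}},2^{\frac{n-4}{2}})$ if $n\equiv 2,4\pmod 8$ and $p\ne0$; $\cong \mathrm{O}(2^{\frac{n-2}{2}},\mathbb{H})$ if $n\equiv 0,6\pmod 8$; $\cong\mathrm{Sp}(2^{\frac{n-3}{2}})\oplus\mathrm{Sp}(2^{\frac{n-3}{2}})$ if $(p,q)=(0,n)$ with $n$ odd; $\cong \mathrm{Sp}(2^{\frac{n-5}{2}},2^{\frac{n-5}{2}})\oplus \mathrm{Sp}(2^{\frac{n-5}{2}},2^{\frac{n-5}{2}})$ if $n\equiv 3\pmod 8$ and $p\ne 0$; $\cong\mathrm{O}(2^{\frac{n-3}{2}},\mathbb{H})\oplus\mathrm{O}(2^{\frac{n-3}{2}},\mathbb{H})$ if $n\equiv 7\pmod 8$; $\cong \mathrm{GL}(2^{\frac{n-3}{2}},\mathbb{H})$ if $n\equiv 1,5\pmod 8$. (iii) If $p-q\equiv 2,3,4\pmod 8$: $G^{2i1}_{p,q}\cong\mathrm{Sp}(2^{\frac{n-2}{2}})$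 if $(p,q)=(n,0)$ with $n$ even; $\cong\mathrm{Sp}(2^{\frac{n-4}{2}},2^{\frac{n-4}{2}})$ if $n\equiv 2,4\pmod 8$ and $q\ne0$; $\cong \mathrm{O}(2^{\frac{n-2}{2}},\mathbb{H})$ if $n\equiv 0,6\pmod 8$; $\cong\mathrm{Sp}(2^{\frac{n-3}{2}})\oplus\mathrm{Sp}(2^{\frac{n-3}{2}})$ if $(p,q)=(n,0)$ with $n$ odd; $\cong \mathrm{Sp}(2^{\frac{n-5}{2}},2^{\frac{n-5}{2}})\oplus \mathrm{Sp}(2^{\frac{n-5}{2}},2^{\frac{n-5}{2}})$ if $n\equiv 3\pmod 8$ and $q\ne 0$; $\cong\mathrm{O}(2^{\frac{n-3}{2}},\mathbb{H})\oplus\mathrm{O}(2^{\frac{n-3}{2}},\mathbb{H})$ if $n\equiv 7\pmod 8$; $\cong \mathrm{GL}(2^{\frac{n-3}{2}},\mathbb{H})$ if $n\equiv 1,5\pmod 8$. (iv) If $p-q\equiv 2,3,4\pmod 8$: $G^{2i3}_{p,q}\cong\mathrm{Sp}(2^{\frac{n-2}{2}})$ if $(p,q)=(0,n)$ with $n$ even; $\cong\mathrm{Sp}(2^{\frac{n-4}{2}},2^{\frac{n-4}{2}})$ if $n\equiv 4,6\pmod 8$ and $p\ne0$; $\cong \mathrm{O}(2^{\frac{n-2}{2}},\mathbb{H})$ if $n\equiv 0,2\pmod 8$; $\cong\mathrm{Sp}(2^{\frac{n-3}{2}})\oplus\mathrm{Sp}(2^{\frac{n-3}{2}})$ if $(p,q)=(0,n)$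 with $n$ odd; $\cong \mathrm{Sp}(2^{\frac{n-5}{2}},2^{\frac{n-5}{2}})\oplus \mathrm{Sp}(2^{\frac{n-5}{2}},2^{\frac{n-5}{2}})$ if $n\equiv 5\pmod 8$ and $p\ne 0$; $\cong\mathrm{O}(2^{\frac{n-3}{2}},\mathbb{H})\oplus\mathrm{O}(2^{\frac{n-3}{2}},\mathbb{H})$ if $n\equiv 1\pmod 8$; $\cong \mathrm{GL}(2^{\frac{n-3}{2}},\mathbb{H})$ if $n\equiv 3,7\pmod 8$. (v) If $p-q\equiv 3,4,5\pmod 8$: $G^{2}_{p,q}\cong\mathrm{Sp}(2^{\frac{n-3}{2}})$ if $(p,q)=(n,0)$ or $(0,n)$ with $n$ odd; $\cong\mathrm{Sp}(2^{\frac{n-5}{2}},2^{\frac{n-5}{2}})$ if $n\equiv 3,5\pmod 8$ and $p,q\ne0$; $\cong \mathrm{O}(2^{\frac{n-3}{2}},\mathbb{H})$ if $n\equiv 1,7\pmod 8$; $\cong\mathrm{Sp}(2^{\frac{n-4}{2}})\oplus\mathrm{Sp}(2^{\frac{n-4}{2}})$ if $(p,q)=(n,0)$ or $(0,n)$ with $n$ even; $\cong \mathrm{Sp}(2^{\frac{n-6}{2}},2^{\frac{n-6}{2}})\oplus \mathrm{Sp}(2^{\frac{n-6}{2}},2^{\frac{n-6}{2}})$ if $n\equiv 4\pmod 8$ and $p,q\ne 0$; $\cong\mathrm{O}(2^{\frac{n-4}{2}},\mathbb{H})\oplus\mathrm{O}(2^{\frac{n-4}{2}},\mathbb{H})$ if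 $n\equiv 0\pmod 8$; $\cong \mathrm{GL}(2^{\frac{n-4}{2}},\mathbb{H})$ if $n\equiv 2,6\pmod 8$.
   Context: $C\!\ell_{p,q}$ is the real Clifford algebra with identity $e$ and generators $e^1,\dots,e^n$ ($n=p+q$) satisfying $e^ae^b+e^be^a=2\eta^{ab}e$, where $\eta=\mathrm{diag}(1,\dots,1,-1,\dots,-1)$ with $p$ entries $+1$ and $q$ entries $-1$; the elements $e$ and $e^{a_1\dots a_k}=e^{a_1}\cdots e^{a_k}$ ($a_1<\dots<a_k$) form a basis. $\mathbb{C}\otimes C\!\ell_{p,q}$ is its complexification (same basis, complex coefficients). $C\!\ell^k_{p,q}$ is the span of basis elements of grade $k$; $C\!\ell^{(0)}_{p,q}=\bigoplus_{k \text{ even}}C\!\ell^k_{p,q}$, $C\!\ell^{(1)}_{p,q}=\bigoplus_{k\text{ odd}}C\!\ell^k_{p,q}$. The grade involution $U\mapsto \hat U$ replaces each $e^a$ by $-e^a$; the reversion $U\mapsto\tilde U$ is the linear map sending $e^{a_1\dots a_r}$ to $e^{a_r}\cdots e^{a_1}$; complex conjugation $U\mapsto \bar U$ conjugates all complex coefficients in the basis expansion; $U^\ddagger=\tilde{\bar U}$. Quaternionic classical groups, with $A^*$ the conjugate transpose of a quaternionic matrix: $\mathrm{GL}(m,\mathbb{H})$ is the group of invertible $m\times m$ quaternionic matrices; $\mathrm{Sp}(m)=\{A\in \mathrm{GL}(m,\mathbb{H}):A^*A=\mathbf 1\}$; $\mathrm{Sp}(r,s)=\{A\in\mathrm{GL}(r+s,\mathbb{H}):A^*\eta_{r,s}A=\eta_{r,s}\}$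 with $\eta_{r,s}=\mathrm{diag}(1,\dots,1,-1,\dots,-1)$ ($r$ ones, $s$ minus ones); $\mathrm{O}(m,\mathbb{H})=\mathrm{O}^*(2m)=\{A\in\mathrm{GL}(m,\mathbb{H}):A^*(i\mathbf 1)A=i\mathbf 1\}$, where $i$ is the quaternion unit $i$. *)

(* Defs.v *)
From HB Require Import structures.
From mathcomp Require Import all_boot all_order all_algebra.
From mathcomp Require Import reals.
Unset Printing Implicit Defensive.
Import Order.TTheory GRing.Theory Num.Theory.
Local Open Scope ring_scope.

(* Abstract "concrete" groups: a carrier with a multiplication, a subset    *)
(* (the group), and real coordinates in a finite-dimensional real vector    *)
(* space giving the (subspace) topology.                                    *)
Record mgrp (R : realType) := MGrp {
  car : Type;
  idx : finType;
  coord : car -> idx -> R;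
  gmul : car -> car -> car;
  gset : car -> Prop }.
Arguments car {R} _.
Arguments idx {R} _.
Arguments coord {R} _ _ _.
Arguments gmul {R} _ _ _.
Arguments gset {R} _ _.

Definition cont_on {R : realType} (G H : mgrp R) (f : car G -> car H) : Prop :=
  forall x, gset G x -> forall eps : R, 0 < eps -> exists2 delta : R, 0 < delta &
    forall y, gset G y -> (forall i, `|coord G x i - coord G y i| < delta) ->
      forall j, `|coord H (f x) j - coord H (f y) j| < eps.

(* isomorphism of (closed linear) Lie groups = bicontinuous group isomorphism *)
Definition lie_iso {R : realType} (G H : mgrp R) : Prop :=
  exists (f : car G -> car H) (g : car H -> car G),
    [/\ (forall x, gset G x -> gset H (f x)),
        (forall y, gset H y -> gset G (g y)),
        (forall x, gset G x -> g (f x) = x),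
        (forall y, gset H y -> f (g y) = y) &
        [/\ (forall x y, gset G x -> gset G y -> f (gmul G x y) = gmul H (f x) (f y)),
            @cont_on R G H f & @cont_on R H G g]].

Definition dupG {R : realType} (H : mgrp R) : mgrp R :=
  @MGrp R (car H * car H)%type (idx H + idx H)%type
    (fun x c => match c with inl i => coord H x.1 i | inr i => coord H x.2 i end)
    (fun x y => (gmul H x.1 y.1, gmul H x.2 y.2))
    (fun x => gset H x.1 /\ gset H x.2).

(* Quaternionic matrices: A = A0 + A1 i + A2 j + A3 k with A_k real m x m.  *)
Record qmx (R : realType) (m : nat) := QM {
  q0 : 'M[R]_m; q1 : 'M[R]_m; q2 : 'M[R]_m; q3 : 'M[R]_m }.
Arguments QM {R m} _ _ _ _.
Arguments q0 {R m} _.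
Arguments q1 {R m} _.
Arguments q2 {R m} _.
Arguments q3 {R m} _.

Definition qmul {R : realType} {m : nat} (A B : qmx R m) : qmx R m :=
  QM (q0 A *m q0 B - q1 A *m q1 B - q2 A *m q2 B - q3 A *m q3 B)
     (q0 A *m q1 B + q1 A *m q0 B + q2 A *m q3 B - q3 A *m q2 B)
     (q0 A *m q2 B - q1 A *m q3 B + q2 A *m q0 B + q3 A *m q1 B)
     (q0 A *m q3 B + q1 A *m q2 B - q2 A *m q1 B + q3 A *m q0 B).

Definition qadj {R : realType} {m : nat} (A : qmx R m) : qmx R m :=
  QM (q0 A)^T (- (q1 A)^T) (- (q2 A)^T) (- (q3 A)^T).

Definition qone (R : realType) (m : nat) : qmx R m := QM 1%:M 0 0 0.
Definition qiI (R : realType) (m : nat) : qmx R m := QM 0 1%:M 0 0.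
Definition qeta (R : realType) (r s : nat) : qmx R (r + s) :=
  QM (diag_mx (\row_(i < r + s) (if (i < r)%N then 1 else -1))) 0 0 0.

Definition qcoord {R : realType} {m : nat} (A : qmx R m) (c : 'I_4 * ('I_m * 'I_m)) : R :=
  (nth (q0 A) [:: q0 A; q1 A; q2 A; q3 A] c.1) c.2.1 c.2.2.

Definition qinvertible {R : realType} {m : nat} (A : qmx R m) : Prop :=
  exists B, qmul A B = qone R m /\ qmul B A = qone R m.

Definition mkQ (R : realType) (m : nat) (P : qmx R m -> Prop) : mgrp R :=
  @MGrp R (qmx R m) ('I_4 * ('I_m * 'I_m))%type (@qcoord R m) (@qmul R m) P.

Definition GLH (R : realType) (m : nat) : mgrp R := mkQ R m (@qinvertible R m).
Definition SpH (R : realType) (m : nat) : mgrp R :=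
  mkQ R m (fun A => qinvertible A /\ qmul (qadj A) A = qone R m).
Definition SpRS (R : realType) (r s : nat) : mgrp R :=
  mkQ R (r + s) (fun A => qinvertible A /\ qmul (qadj A) (qmul (qeta R r s) A) = qeta R r s).
(* O(m,H) = O^*(2m) *)
Definition OH (R : realType) (m : nat) : mgrp R :=
  mkQ R m (fun A => qinvertible A /\ qmul (qadj A) (qmul (qiI R m) A) = qiI R m).

(* Real Clifford algebra Cl_{p,q}, n = p + q: an element is the family of   *)
(* its coordinates on the basis e^A, A ranging over subsets of {0..n-1}     *)
(* (A = {a1<..<ak} <-> e^{a1..ak}; A = set0 <-> e).                         *)
Definition cl (R : realType) (n : nat) : Type := {set 'I_n} -> R.

Definition eta {R : realType} (p : nat) {n : nat} (a : 'I_n) : R :=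
  if (a < p)%N then 1 else -1.

Definition symd {n : nat} (A B : {set 'I_n}) : {set 'I_n} := (A :\: B) :|: (B :\: A).

(* e^A e^B = bsign A B e^(A symdiff B) *)
Definition bsign {R : realType} (p : nat) {n : nat} (A B : {set 'I_n}) : R :=
  (-1) ^+ #|[set x : 'I_n * 'I_n | [&& x.1 \in A, x.2 \in B & (x.2 < x.1)%N]]|
  * \prod_(a in A :&: B) eta p a.

Definition clmul {R : realType} (p : nat) {n : nat} (x y : cl R n) : cl R n :=
  fun C => \sum_(A : {set 'I_n}) \sum_(B : {set 'I_n} | symd A B == C)
             bsign p A B * x A * y B.

Definition clone (R : realType) (n : nat) : cl R n := fun C => (C == set0)%:R.
Definition clzero (R : realType) (n : nat) : cl R n := fun _ => 0.
Definition gen (R : realType) {n : nat} (a : 'I_n) : cl R n := fun C => (C == [set a])%:R.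
Definition cladd {R : realType} {n : nat} (x y : cl R n) : cl R n := fun C => x C + y C.
Definition clopp {R : realType} {n : nat} (x : cl R n) : cl R n := fun C => - x C.

Definition clhat {R : realType} {n : nat} (x : cl R n) : cl R n :=
  fun A => (-1) ^+ #|A| * x A.
Definition clrev {R : realType} (p : nat) {n : nat} (x : cl R n) : cl R n :=
  fun C => \sum_(A : {set 'I_n})
             x A * (foldr (@clmul R p n) (clone R n) (map (@gen R n) (rev (enum A)))) C.

Definition cleven {R : realType} {n : nat} (x : cl R n) : Prop :=
  forall A : {set 'I_n}, odd #|A| -> x A = 0.
Definition clodd {R : realType} {n : nat} (x : cl R n) : Prop :=
  forall A : {set 'I_n}, ~~ odd #|A| -> x A = 0.

(* complexification C (x) Cl_{p,q}: U = U.1 + i U.2 *)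
Definition ccl (R : realType) (n : nat) : Type := (cl R n * cl R n)%type.
Definition cmul {R : realType} (p : nat) {n : nat} (U V : ccl R n) : ccl R n :=
  (cladd (clmul p U.1 V.1) (clopp (clmul p U.2 V.2)),
   cladd (clmul p U.1 V.2) (clmul p U.2 V.1)).
Definition cone (R : realType) (n : nat) : ccl R n := (clone R n, clzero R n).
Definition cconj {R : realType} {n : nat} (U : ccl R n) : ccl R n := (U.1, clopp U.2).
Definition chat {R : realType} {n : nat} (U : ccl R n) : ccl R n := (clhat U.1, clhat U.2).
Definition crev {R : realType} (p : nat) {n : nat} (U : ccl R n) : ccl R n :=
  (clrev p U.1, clrev p U.2).
Definition cdag {R : realType} (p : nat) {n : nat} (U : ccl R n) : ccl R n :=
  crev p (cconj U).

Definition mkCl (R : realType) (p q : nat) (P : cl R (p + q) -> Prop) : mgrp R :=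
  @MGrp R (cl R (p + q)) {set 'I_(p + q)} (fun x A => x A) (@clmul R p (p + q)) P.
Definition mkCCl (R : realType) (p q : nat) (P : ccl R (p + q) -> Prop) : mgrp R :=
  @MGrp R (ccl R (p + q)) ({set 'I_(p + q)} + {set 'I_(p + q)})%type
    (fun U c => match c with inl A => U.1 A | inr A => U.2 A end)
    (@cmul R p (p + q)) P.

Definition G2i1 (R : realType) (p q : nat) : mgrp R :=
  mkCCl R p q (fun U => [/\ cleven U.1, clodd U.2 & cmul p (cdag p U) U = cone R (p + q)]).
Definition G2i3 (R : realType) (p q : nat) : mgrp R :=
  mkCCl R p q (fun U => [/\ cleven U.1, clodd U.2 & cmul p (cdag p (chat U)) U = cone R (p + q)]).
Definition G23 (R : realType) (p q : nat) : mgrp R :=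
  mkCl R p q (fun U => clmul p (clrev p U) U = clone R (p + q)).
Definition G12 (R : realType) (p q : nat) : mgrp R :=
  mkCl R p q (fun U => clmul p (clrev p (clhat U)) U = clone R (p + q)).
Definition G2 (R : realType) (p q : nat) : mgrp R :=
  mkCl R p q (fun U => cleven U /\ clmul p (clrev p U) U = clone R (p + q)).

(* (p - q) mod 8, computed in nat as (p + 7 q) mod 8 *)
Definition pqmod8 (p q : nat) : nat := ((p + 7 * q) %% 8)%N.

(* Main.v *)
(* Each of the five groups lives in a twisted group algebra, over R, of an     *)
(* elementary abelian 2-group V of subsets of the generators (all subsets, or *)
(* the even ones): basis elements multiply as e_u e_v = (-1)^(b u v) e_(u+v)  *)
(* with b bilinear over F_2, so e_v^2 = (-1)^(Q v) for the quadratic form     *)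
(* Q v = b v v, and the anti-involution e_v |-> (-1)^(s v) e_v defining the   *)
(* group has a sign s with the same polar form as Q.  A hyperbolic plane of Q *)
(* splits off a factor M_2(R), an anisotropic one a factor H; if Q is         *)
(* nondegenerate and its Gauss sum is negative, the algebra is M_m(H) with    *)
(* conjugate transposition e_v |-> e_v^-1.  Then s - Q is the character       *)
(* polar(., P) of some P, the group is {A | A^* e_P A = e_P}, and e_P can be  *)
(* taken to be 1, diag(1,-1) or i according to P = 0, Q P = 0 <> P, Q P = 1;  *)
(* Q P is read off from the Gauss sums of s and Q.  If Q has a radical        *)
(* {0, om}, the central idempotents (1 + e_om)/2 and (1 - e_om)/2 split the   *)
(* algebra into two copies of M_m(H), fixed by the anti-involution when       *)
(* s om = 0 and exchanged when s om = 1, which gives GL(m,H).  The Gauss sums *)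
(* come from (1 + i)^p (1 - i)^q, hence the dependence on residues modulo 8.  *)
Require Import Defs.
From HB Require Import structures.
From mathcomp Require Import all_boot all_order all_algebra.
From mathcomp Require Import reals boolp.
From mathcomp Require Import zify ring lra.

Import Order.TTheory GRing.Theory Num.Theory.

Set Implicit Arguments.
Unset Strict Implicit.

(** All five families are instances of one object, [TG R b V0 s]: the elements [x] of a twisted
    group algebra supported on [V0] with [sig s x * x = 1] ([G23_TG], [G12_TG], [G2_TG], [G2i1_TG],
    [G2i3_TG]). The square sign [qf b] and the involution sign [s] are two quadratic forms over F_2
    with the same polar form ([qf_bcl_quadratic]), and the group is read off from this pair.

    The algebra comes from Arf reduction. Splitting off an orthogonal plane divides the Gauss sum by
    2 or -2 ([gam_perp]). A negative sum therefore provides an anisotropic plane whose complement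
    has positive sum ([quaternion_mate], [gam_perp_quat]): the plane gives H ([quat_rep_qrep]) and
    the complement a real matrix algebra ([split_rep]).

    The involution comes from linear duality: [s] and [qf b] differ by [pol] against a vector [P]
    ([char_represented]), and comparing their Gauss sums gives [qf b P] ([gam_pol]). Since [P] can
    be chosen as one of the vectors on which the matrix model is built, the invariant form becomes
    the standard one ([qrep_imaginary], [qrep_isotropic], [qform_group]).

    In odd dimension the polar form has a radical, and a hyperplane complementing it reduces to the
    nondegenerate case ([TG_dup], [TG_GL]). The signs of all Gauss sums are in [gauss_signs]:
    [p - q] modulo 8 governs [qf b], and [n] modulo 8 governs [s]. The isomorphisms are linear in
    coordinates except for the inverse occurring in the GL case, whose continuity is
    [cont_on_GL]. *)

(** * Quadratic forms over F_2 and their Gauss sums *)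

Section QuadraticSpaces.
Local Open Scope ring_scope.
Variable n : nat.
Local Notation V := {set 'I_n}.
Local Notation "A :+: B" := (symd A B) (at level 50, left associativity).

Lemma in_symd (z : 'I_n) (A B : V) : (z \in A :+: B) = (z \in A) (+) (z \in B).
Proof. by rewrite !inE; case: (z \in A); case: (z \in B). Qed.

Ltac symd_tac := apply/setP => ?; rewrite ?(in_symd, inE);
  repeat match goal with |- context [?z \in ?A] => case: (z \in A) end.

Lemma symdA (A B C : V) : A :+: (B :+: C) = A :+: B :+: C.
Proof. by symd_tac. Qed.
Lemma symdC (A B : V) : A :+: B = B :+: A.
Proof. by symd_tac. Qed.
Lemma symdd (A : V) : A :+: A = set0.
Proof. by symd_tac. Qed.
Lemma symd0 (A : V) : A :+: set0 = A.
Proof. by symd_tac. Qed.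
Lemma sym0d (A : V) : set0 :+: A = A.
Proof. by symd_tac. Qed.
Lemma symdK (A B : V) : A :+: (A :+: B) = B.
Proof. by symd_tac. Qed.
Lemma symdKr (A B : V) : B :+: A :+: A = B.
Proof. by symd_tac. Qed.
Lemma symd_inj (A : V) : injective (symd A).
Proof. exact: can_inj (symdK A). Qed.
Lemma symdI (A : V) : injective (fun B => B :+: A).
Proof. exact: (can_inj (g := fun B => B :+: A) (symdKr A)). Qed.
Lemma symd_eq (A B C : V) : (A :+: B == C) = (B == A :+: C).
Proof. by apply/eqP/eqP => [<-|->]; rewrite symdK. Qed.
(* A bilinear 2-cocycle on the elementary abelian 2-group of subsets, with   *)
(* values written additively in [bool].                                      *)
Structure bich := Bich {
  bb :> V -> V -> bool;
  bbDl : forall u v w, bb (u :+: v) w = bb u w (+) bb v w;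
  bbDr : forall u v w, bb w (u :+: v) = bb w u (+) bb w v }.

Variable b : bich.
Implicit Types (W : {set V}) (u v w x y : V).

Definition qf (v : V) := b v v.
Definition pol (u v : V) := b u v (+) b v u.

Lemma bb0l v : b set0 v = false.
Proof. by rewrite -(symdd v) bbDl addbb. Qed.
Lemma bb0r v : b v set0 = false.
Proof. by rewrite -(symdd v) bbDr addbb. Qed.
Lemma qf0 : qf set0 = false. Proof. exact: bb0l. Qed.
Lemma qfD u v : qf (u :+: v) = qf u (+) qf v (+) pol u v.
Proof.
by rewrite /qf /pol !bbDl !bbDr; case: (b u u); case: (b u v); case: (b v u); case: (b v v).
Qed.
Lemma polC u v : pol u v = pol v u. Proof. exact: addbC. Qed.
Lemma polvv v : pol v v = false. Proof. exact: addbb. Qed.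
Lemma polDl u v w : pol (u :+: v) w = pol u w (+) pol v w.
Proof. by rewrite /pol bbDl bbDr; do 4!case: (b _ _). Qed.
Lemma polDr u v w : pol w (u :+: v) = pol w u (+) pol w v.
Proof. by rewrite ![pol w _]polC polDl. Qed.
Lemma pol0l v : pol set0 v = false. Proof. by rewrite /pol bb0l bb0r. Qed.
Lemma pol0r v : pol v set0 = false. Proof. by rewrite polC pol0l. Qed.

Definition subsp (W : {set V}) :=
  (set0 \in W) /\ (forall u v, u \in W -> v \in W -> u :+: v \in W).
Definition nondeg (W : {set V}) :=
  forall w, w \in W -> w != set0 -> exists2 u, u \in W & pol w u.
(** The Gauss sum of [f]; for [f = qf b] on a nondegenerate [W] its sign is the Arf invariant. *)
Definition gam (W : {set V}) (f : V -> bool) : int := \sum_(w in W) (-1) ^+ f w.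
Definition perp (W : {set V}) x y := [set w in W | ~~ pol w x & ~~ pol w y].

Lemma subspK W : subsp W -> forall u v, u \in W -> (u :+: v \in W) = (v \in W).
Proof.
move=> [_ hW] u v uW; apply/idP/idP => [h|]; last exact: hW.
by rewrite -(symdK u v) hW.
Qed.

Lemma subspKr W : subsp W -> forall u v, u \in W -> (v :+: u \in W) = (v \in W).
Proof. by move=> hW u v uW; rewrite symdC subspK. Qed.

Lemma perpP W x y w : reflect [/\ w \in W, pol w x = false & pol w y = false] (w \in perp W x y).
Proof.
rewrite inE; apply: (iffP and3P) => [[-> /negbTE -> /negbTE ->]|[-> -> ->]] //.
Qed.

Lemma subsp_perp W x y : subsp W -> subsp (perp W x y).
Proof.
move=> [W0 WD]; split; first by apply/perpP; rewrite !pol0l.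
move=> u v /perpP[uW ux uy] /perpP[vW vx vy]; apply/perpP.
by rewrite WD // !polDl ux uy vx vy.
Qed.

(** The plane spanned by [x] and [y] is a complement of [perp W x y]: the pair ([pol w x],
    [pol w y]) tells in which of the four translates [w] lies. *)
Lemma perp_sum (S : nmodType) W x y (f : V -> S) :
  subsp W -> x \in W -> y \in W -> pol x y ->
  \sum_(w in W) f w =
    \sum_(w in perp W x y) (f w + f (w :+: x) + f (w :+: y) + f (w :+: (x :+: y))).
Proof.
move=> hW xW yW xy.
have xyW : x :+: y \in W by rewrite subspK.
have part c al be : c \in W -> pol c x = al -> pol c y = be ->
  \sum_(w in W | (pol w x == al) && (pol w y == be)) f w = \sum_(w in perp W x y) f (w :+: c).
  move=> cW cx cy; rewrite (reindex_inj (@symdI c)); apply: eq_bigl => w.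
  rewrite subspKr // !inE !polDl cx cy.
  by case: (w \in W) => //=; case: al {cx}; case: be {cy};
     case: (pol w x); case: (pol w y).
have yx : pol y x by rewrite polC.
rewrite !big_split /=.
rewrite -(part x false true) ?polvv // -(part y true false) ?polvv //.
rewrite -(part (x :+: y) true true) // ?polDl ?polvv ?xy ?yx //.
have -> : \sum_(w in perp W x y) f w = \sum_(w in W | (pol w x == false) && (pol w y == false)) f w.
  by apply: eq_bigl => w; rewrite inE; case: (pol w x); case: (pol w y); case: (w \in W).
rewrite (bigID (fun w => pol w x)) /= [X in X + _](bigID (fun w => pol w y)).
rewrite [X in _ + X](bigID (fun w => pol w y)) /=.
rewrite addrC [X in X + _]addrC [X in _ + X]addrC addrA; congr (_ + _ + _ + _); apply: eq_bigl => w;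
  by case: (w \in W); case: (pol w x); case: (pol w y).
Qed.

Lemma nondeg_perp W x y : subsp W -> x \in W -> y \in W -> pol x y ->
  nondeg W -> nondeg (perp W x y).
Proof.
move=> hW xW yW xy nd w /perpP[wW wx wy] w0.
have [u uW wu] := nd w wW w0.
(* The orthogonal projection of [u]: adding [x] repairs [pol u y], adding [y] repairs [pol u x], and
   neither changes [pol w u]. *)
exists (u :+: (if pol u y then x else set0) :+: (if pol u x then y else set0)).
  apply/perpP; split.
  - by do 2!case: ifP => _; rewrite !(subspKr hW) //; apply: hW.1.
  - by rewrite !polDl; case: (pol u y); case: ifP => ux;
       rewrite ?polvv ?pol0l ?[pol y x]polC ?xy.
  - by rewrite !polDl; case: ifP => ux; case: (pol u x);
       rewrite ?polvv ?pol0l ?xy.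
by rewrite !polDr wu; do 2!case: ifP; rewrite ?wx ?wy ?pol0r.
Qed.

Lemma card_perp W x y : subsp W -> x \in W -> y \in W -> pol x y ->
  #|W| = (4 * #|perp W x y|)%N.
Proof.
move=> hW xW yW xy; rewrite -!sum1_card.
apply: etrans (perp_sum (S := nat) (fun _ => 1%N) hW xW yW xy) _.
by rewrite big_distrr /=; apply: eq_bigr.
Qed.

(** The last factor is the Gauss sum of the plane, because [qf (x :+: y)] is the negation of
    [qf x (+) qf y]. It is -2 when [qf x] and [qf y] both hold (anisotropic plane) and 2
    otherwise. *)
Lemma gam_perp W x y : subsp W -> x \in W -> y \in W -> pol x y ->
  gam W qf = gam (perp W x y) qf * (1 + (-1) ^+ qf x + (-1) ^+ qf y - (-1) ^+ qf x * (-1) ^+ qf y).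
Proof.
move=> hW xW yW xy; rewrite /gam (perp_sum _ hW xW yW xy) mulr_suml.
apply: eq_bigr => w /perpP[_ wx wy]; rewrite !qfD polDr wx wy xy.
by case: (qf w); case: (qf x); case: (qf y).
Qed.

Lemma gam_lt0 W : gam W qf < 0 -> exists2 w, w \in W & qf w.
Proof.
move=> h; have [/exists_inP[w wW qw]|] := boolP [exists w in W, qf w]; first by exists w.
rewrite negb_exists_in => /forall_inP h'; move: h; rewrite ltNge => /negP[].
by apply: sumr_ge0 => w /h' /negbTE ->.
Qed.

(** Take [y] with [pol i y]. If [qf y] fails, the plane is hyperbolic, so its complement keeps a
    negative Gauss sum and contains [w] with [qf w]; then [y :+: w] is the mate. *)
Lemma quaternion_mate W i : subsp W -> nondeg W -> gam W qf < 0 -> i \in W -> qf i ->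
  exists j, [/\ j \in W, qf j & pol i j].
Proof.
move=> hW nd g iW qi.
have i0 : i != set0 by apply: contraTneq qi => ->; rewrite qf0.
have [y yW iy] := nd i iW i0.
have [qy|qy] := boolP (qf y); first by exists y.
have := gam_perp hW iW yW iy; rewrite qi (negbTE qy) => gE.
have [|w] := @gam_lt0 (perp W i y); first by move: g; rewrite gE /=; lia.
move=> /perpP[wW wi wy] qw; exists (y :+: w); split.
- by rewrite subspK.
- by rewrite qfD (negbTE qy) qw polC wy.
- by rewrite polDr iy polC wi.
Qed.

Lemma hyperbolic_mate W x : subsp W -> nondeg W -> x \in W -> x != set0 -> qf x = false ->
  exists y, [/\ y \in W, qf y = false & pol x y].
Proof.
move=> hW nd xW x0 qx; have [y yW xy] := nd x xW x0.
have [qy|/negbTE qy] := boolP (qf y); last by exists y.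
by exists (y :+: x); rewrite subspK // qfD qy qx polDr xy polvv polC xy.
Qed.

(** Without a nonzero isotropic vector the Gauss sum would be [1 - (#|W| - 1)], which is negative
    here. *)
Lemma isotropic_exists W : subsp W -> 0 < gam W qf -> (2 < #|W|)%N ->
  exists x, [/\ x \in W, x != set0 & qf x = false].
Proof.
move=> hW g cW.
have [/exists_inP[x xW /andP[x0 /negbTE qx]]|] :=
  boolP [exists x in W, (x != set0) && ~~ qf x]; first by exists x.
rewrite negb_exists_in => /forall_inP h; move: g.
rewrite /gam (bigD1 set0) ?hW.1 //= qf0 (eq_bigr (fun _ => -1)); last first.
  by move=> x /andP[xW x0]; move: (h x xW); rewrite x0 /= negbK => ->.
rewrite big_const iter_addr_0 /=.
have -> : #|[pred i in W | i != set0]| = #|W :\ set0|.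
  by apply: eq_card => x; rewrite !inE andbC.
move: cW; rewrite (cardsD1 set0 W) hW.1 add1n ltnS => c.
by rewrite mulNrn natz expr0; move: #|_| c => k c g; exfalso; lia.
Qed.

Lemma char_sum0 W (l : V -> bool) w0 : subsp W -> w0 \in W -> l w0 ->
  (forall w, w \in W -> l (w :+: w0) = ~~ l w) -> \sum_(w in W) (-1) ^+ l w = 0 :> int.
Proof.
move=> hW w0W lw0 hl; set S := \sum_(_ in _) _.
have : S = - S.
  rewrite {1}/S (reindex_inj (@symdI w0)) -sumrN; apply: eq_big => w.
    by rewrite subspKr.
  by rewrite subspKr // => wW; rewrite hl //; case: (l w).
by lia.
Qed.

(** Fourier argument: the correlations [S P] of [l] with the characters [pol w P] add up to [#|W|],
    so some [S P] is nonzero, and a character with nonzero sum is trivial by [char_sum0]. *)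
Lemma char_represented W (l : V -> bool) : subsp W -> nondeg W ->
  (forall u v, u \in W -> v \in W -> l (u :+: v) = l u (+) l v) ->
  exists2 P, P \in W & forall w, w \in W -> l w = pol w P.
Proof.
move=> hW nd lD.
have l0 : l set0 = false by rewrite -(symdd set0) lD ?hW.1 // addbb.
pose S P : int := \sum_(w in W) (-1) ^+ (l w (+) pol w P).
have SE : \sum_(P in W) S P = #|W|%:Z.
  rewrite exchange_big (bigD1 set0) ?hW.1 //= [X in _ + X]big1 ?addr0.
    rewrite (eq_bigr (fun _ => 1)); first by rewrite sumr_const natz.
    by move=> P _; rewrite l0 pol0l.
  move=> w /andP[wW w0]; have [u uW wu] := nd w wW w0.
  rewrite (eq_bigr (fun P => (-1) ^+ l w * (-1) ^+ pol w P)); last first.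
    by move=> P _; case: (l w); case: (pol w P).
  rewrite -mulr_sumr (@char_sum0 _ _ u) ?mulr0 // => v vW.
  by rewrite polDr wu addbT.
have [/exists_inP[P PW SP]|] := boolP [exists P in W, S P != 0]; last first.
  rewrite negb_exists_in => /forall_inP h; move: SE; rewrite big1.
    by rewrite (cardsD1 set0 W) hW.1; move: #|_| => k h0; exfalso; lia.
  by move=> P /h; rewrite negbK => /eqP.
exists P => // w wW; apply/eqP; apply: contraNT SP => hw.
rewrite /S (@char_sum0 _ _ w) //; first by move: hw; case: (l w); case: (pol w P).
move=> v vW; rewrite lD // polDl; move: hw.
by case: (l w); case: (l v); case: (pol w P); case: (pol v P).
Qed.

(** Completing the square: [s w = qf (w :+: P) (+) qf P], so [s] is a translate of [qf] up to a
    constant. *)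
Lemma gam_pol W P (s : V -> bool) : subsp W -> P \in W ->
  (forall w, w \in W -> s w = qf w (+) pol w P) ->
  gam W s = (-1) ^+ qf P * gam W qf.
Proof.
move=> hW PW hs; rewrite /gam [in RHS](reindex_inj (@symdI P)) mulr_sumr.
apply: eq_big => w; first by rewrite subspKr.
by move=> wW; rewrite qfD hs //; case: (qf w); case: (qf P); case: (pol w P).
Qed.

(** * Hyperplanes complementary to a vector *)

Section Hyperplane.
Variables (V0 : {set {set 'I_n}}) (om : V) (l : V -> bool).
Hypotheses (hV0 : subsp V0) (omV : om \in V0) (lom : l om).
Hypothesis lD : forall u v, l (u :+: v) = l u (+) l v.

Definition hyperplane := [set v in V0 | ~~ l v].

Lemma hyperplane_sub v : v \in hyperplane -> v \in V0.
Proof. by rewrite inE => /andP[]. Qed.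

Lemma subsp_hyperplane : subsp hyperplane.
Proof.
have l0 : l set0 = false by rewrite -(symdd set0) lD addbb.
split; first by rewrite inE hV0.1 l0.
move=> u v; rewrite !inE => /andP[uV lu] /andP[vV lv].
by rewrite subspK // vV lD (negbTE lu) lv.
Qed.

Lemma hyperplane_sum (S : nmodType) (f : V -> S) :
  \sum_(v in V0) f v = \sum_(w in hyperplane) (f w + f (w :+: om)).
Proof.
rewrite big_split /= (bigID l) /= addrC; congr (_ + _).
  by apply: eq_bigl => v; rewrite inE.
rewrite (reindex_inj (@symdI om)); apply: eq_bigl => v.
by rewrite inE subspKr // lD lom addbT.
Qed.

Lemma card_hyperplane : #|V0| = (2 * #|hyperplane|)%N.
Proof.
rewrite -!sum1_card.
apply: etrans (hyperplane_sum (S := nat) (fun _ => 1%N)) _.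
by rewrite big_distrr.
Qed.

Lemma gam_hyperplane (s : V -> bool) : (forall v, v \in V0 -> s (v :+: om) = s v) ->
  gam V0 s = 2 * gam hyperplane s.
Proof.
move=> hs; rewrite /gam hyperplane_sum mulr_sumr; apply: eq_bigr => w /hyperplane_sub wV.
by rewrite hs // -mulr2n mulr_natl.
Qed.

(** Adding the radical vector [om] moves a witness into the hyperplane without changing its
    pairings. *)
Lemma nondeg_hyperplane : (forall v, v \in V0 -> pol v om = false) ->
  (forall w, w \in V0 -> w != set0 -> w != om -> exists2 u, u \in V0 & pol w u) ->
  nondeg hyperplane.
Proof.
move=> om0 nd w wW w0.
have wom : w != om by apply: contraTneq wW => ->; rewrite inE lom andbF.
have [u uV wu] := nd w (hyperplane_sub wW) w0 wom.
have wom0 := om0 w (hyperplane_sub wW).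
have [lu|lu] := boolP (l u); last by exists u; rewrite // inE uV.
by exists (u :+: om); rewrite ?inE ?subspKr ?uV ?lD ?lu ?lom // polDr wu wom0.
Qed.

End Hyperplane.

End QuadraticSpaces.

Arguments qf : simpl never.
Arguments pol : simpl never.

(** * Twisted group algebras *)

(** The index [b] gives each cocycle its own ring structure on the same function space. *)
Definition tw (R : realType) (n : nat) (b : bich n) : Type := {ffun {set 'I_n} -> R}.

Section TwistedAlgebra.
Local Open Scope ring_scope.
Variables (R : realType) (n : nat) (b : bich n).
Local Notation V := {set 'I_n}.
Local Notation "A :+: B" := (symd A B) (at level 50, left associativity).
Local Notation A := (tw R b).

HB.instance Definition _ := GRing.Lmodule.copy A {ffun V -> R^o}.

Definition mon (v : V) : A := [ffun w => (w == v)%:R].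
Definition twmul (x y : A) : A :=
  [ffun C => \sum_(u : V) (-1) ^+ b u (u :+: C) * x u * y (u :+: C)].

Lemma tw_addE (x y : A) v : (x + y) v = x v + y v. Proof. by rewrite ffunE. Qed.
Lemma tw_oppE (x : A) v : (- x) v = - x v. Proof. by rewrite ffunE. Qed.
Lemma tw_scaleE a (x : A) v : (a *: x) v = a * x v. Proof. by rewrite ffunE. Qed.
Lemma tw_0E v : (0 : A) v = 0. Proof. by rewrite ffunE. Qed.

Lemma twmulA : associative twmul.
Proof.
move=> x y z; apply/ffunP => C; rewrite !ffunE.
under [LHS]eq_bigr => u _ do rewrite ffunE mulr_sumr.
under [RHS]eq_bigr => u _ do rewrite ffunE mulr_sumr mulr_suml.
rewrite [RHS]exchange_big /=; apply: eq_bigr => u _.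
rewrite [RHS](reindex_inj (@symd_inj _ u)) /=; apply: eq_bigr => v _.
have -> : u :+: (u :+: v) = v by rewrite symdK.
have -> : u :+: v :+: C = v :+: (u :+: C) by rewrite symdA (symdC v).
have -> : (-1) ^+ b (u :+: v) (v :+: (u :+: C)) =
  (-1) ^+ b u (u :+: C) * (-1) ^+ b u v * (-1) ^+ b v (v :+: (u :+: C)) :> R.
  rewrite !bbDl !bbDr.
  by do 6!case: (b _ _); rewrite ?expr0 ?expr1 ?mulr1 ?mul1r ?mulrN1 ?mulN1r ?opprK.
have e (s : bool) : (-1) ^+ s * (-1) ^+ s = 1 :> R by case: s; rewrite ?mulrNN mulr1.
have := e (b u v); set a := (-1) ^+ b u v; move=> ea.
(* The sign [a] of [b u v] occurs twice on the right: once from the inner product, once from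
   expanding the outer cocycle value bilinearly. *)
transitivity (a * a * ((-1) ^+ b u (u :+: C) * x u * ((-1) ^+ b v (v :+: (u :+: C)) * y v * z (v :+: (u :+: C))))).
  by rewrite ea mul1r.
ring.
Qed.

Lemma tw_mul1r : left_id (mon set0) twmul.
Proof.
move=> x; apply/ffunP => C; rewrite ffunE (bigD1 set0) //= big1; last first.
  by move=> u /negbTE u0; rewrite ffunE u0 mulr0 mul0r.
by rewrite ffunE eqxx sym0d bb0l expr0 !mul1r addr0.
Qed.

Lemma tw_mulr1 : right_id (mon set0) twmul.
Proof.
move=> x; apply/ffunP => C; rewrite ffunE (bigD1 C) //= big1; last first.
  by move=> u /negbTE u0; rewrite ffunE symd_eq symd0 eq_sym u0 mulr0.
by rewrite ffunE symdd eqxx bb0r expr0 mul1r mulr1 addr0.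
Qed.

Lemma tw_mulDl : left_distributive twmul +%R.
Proof.
move=> x y z; apply/ffunP => C; rewrite !ffunE -big_split; apply: eq_bigr => u _.
by rewrite !ffunE /=; ring.
Qed.

Lemma tw_mulDr : right_distributive twmul +%R.
Proof.
move=> x y z; apply/ffunP => C; rewrite !ffunE -big_split; apply: eq_bigr => u _.
by rewrite !ffunE /=; ring.
Qed.

Lemma tw_1neq0 : mon set0 != 0.
Proof.
by apply/eqP => /ffunP /(_ set0); rewrite !ffunE eqxx => /eqP; rewrite oner_eq0.
Qed.

HB.instance Definition _ := GRing.Zmodule_isNzRing.Build A
  twmulA tw_mul1r tw_mulr1 tw_mulDl tw_mulDr tw_1neq0.

Lemma tw_scalerAl (a : R) (x y : A) : a *: (x * y) = a *: x * y.
Proof.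
apply/ffunP => C; rewrite !ffunE scaler_sumr; apply: eq_bigr => u _.
by rewrite !ffunE /= /GRing.scale /=; ring.
Qed.
HB.instance Definition _ := GRing.Lmodule_isLalgebra.Build R A tw_scalerAl.

Lemma tw_scalerAr (a : R) (x y : A) : a *: (x * y) = x * (a *: y).
Proof.
apply/ffunP => C; rewrite !ffunE scaler_sumr; apply: eq_bigr => u _.
by rewrite !ffunE /= /GRing.scale /=; ring.
Qed.
HB.instance Definition _ := GRing.Lalgebra_isAlgebra.Build R A tw_scalerAr.

Lemma tw_mulE (x y : A) C :
  (x * y) C = \sum_(u : V) (-1) ^+ b u (u :+: C) * x u * y (u :+: C).
Proof. by rewrite ffunE. Qed.

Lemma mon0 : mon set0 = 1. Proof. by []. Qed.

Lemma monM u v : mon u * mon v = (-1) ^+ b u v *: mon (u :+: v).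
Proof.
apply/ffunP => C; rewrite tw_mulE (bigD1 u) //= big1; last first.
  by move=> w /negbTE wu; rewrite !ffunE wu mulr0 mul0r.
rewrite tw_scaleE !ffunE eqxx addr0 mulr1 symd_eq.
by case: eqP => [->|]; rewrite ?symdK ?mulr0 ?mulr1.
Qed.

Lemma mon_comm u v : mon u * mon v = (-1) ^+ pol b u v *: (mon v * mon u).
Proof.
rewrite !monM (symdC v) scalerA; congr (_ *: _); rewrite /pol.
by case: (b u v); case: (b v u); rewrite ?mulr1 ?mul1r ?mulrNN ?mulr1.
Qed.

Lemma tw_monE (x : A) : x = \sum_v x v *: mon v.
Proof.
apply/ffunP => w; rewrite sum_ffunE (bigD1 w) //= big1; last first.
  by move=> v /negbTE vw; rewrite tw_scaleE ffunE eq_sym vw mulr0.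
by rewrite tw_scaleE ffunE eqxx mulr1 addr0.
Qed.

Lemma mulr_monE (x : A) v C : (x * mon v) C = (-1) ^+ b (C :+: v) v * x (C :+: v).
Proof.
rewrite tw_mulE (bigD1 (C :+: v)) //= big1; last first.
  by move=> u /negbTE h; rewrite ffunE (symdC u) symd_eq h mulr0.
have -> : C :+: v :+: C = v by rewrite symdC symdK.
by rewrite ffunE eqxx mulr1 addr0.
Qed.

Implicit Types (W : {set V}) (u v w : V) (x y : A).
Definition sup (W : {set V}) (x : A) := forall v, v \notin W -> x v = 0.

Lemma sup_mon W v : v \in W -> sup W (mon v).
Proof.
by move=> vW w wW; rewrite ffunE; case: eqP => // wv; rewrite wv vW in wW.
Qed.
Lemma supD W x y : sup W x -> sup W y -> sup W (x + y).
Proof. by move=> hx hy v vW; rewrite tw_addE hx ?hy ?addr0. Qed.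
Lemma supZ W a x : sup W x -> sup W (a *: x).
Proof. by move=> hx v vW; rewrite tw_scaleE hx ?mulr0. Qed.
Lemma supM W x y : subsp W -> sup W x -> sup W y -> sup W (x * y).
Proof.
move=> hW hx hy v vW; rewrite tw_mulE big1 // => u _.
have [uW|uW] := boolP (u \in W); last by rewrite hx // mulr0 mul0r.
by rewrite hy ?mulr0 // subspK.
Qed.
Lemma supS W W' x : {subset W <= W'} -> sup W x -> sup W' x.
Proof. by move=> h hx v vW; apply: hx; apply: contra vW; apply: h. Qed.
Lemma sup_sum W x : sup W x -> x = \sum_(v in W) x v *: mon v.
Proof.
move=> hx; rewrite {1}(tw_monE x) (bigID [in W]) /= [X in _ + X]big1 ?addr0 //.
by move=> v vW; rewrite hx // scale0r.
Qed.
Lemma sup_commute W x v : sup W x -> (forall w, w \in W -> pol b w v = false) ->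
  x * mon v = mon v * x.
Proof.
move=> hx hv; rewrite (sup_sum hx) mulr_suml mulr_sumr; apply: eq_bigr => w wW.
by rewrite -tw_scalerAl -tw_scalerAr mon_comm hv // expr0 scale1r.
Qed.

Definition sig (s : V -> bool) (x : A) : A := [ffun v => (-1) ^+ s v * x v].

Lemma sigE s x v : sig s x v = (-1) ^+ s v * x v. Proof. by rewrite ffunE. Qed.
Lemma sigD s x y : sig s (x + y) = sig s x + sig s y.
Proof. by apply/ffunP => v; rewrite !ffunE mulrDr. Qed.
Lemma sigZ s a x : sig s (a *: x) = a *: sig s x.
Proof. by apply/ffunP => v; rewrite !(sigE, tw_scaleE) mulrCA. Qed.
Lemma sig_mon s v : sig s (mon v) = (-1) ^+ s v *: mon v.
Proof.
by apply/ffunP => w; rewrite sigE tw_scaleE !ffunE; case: eqP => [->|_]; rewrite ?mulr0.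
Qed.
Lemma sigK s x : sig s (sig s x) = x.
Proof.
by apply/ffunP => v; rewrite !ffunE signrMK.
Qed.
Lemma sig_sup s W x : sup W x -> sup W (sig s x).
Proof. by move=> hx v vW; rewrite sigE hx ?mulr0. Qed.
Lemma eq_sig W s s' x : sup W x -> (forall v, v \in W -> s v = s' v) -> sig s x = sig s' x.
Proof.
move=> hx h; apply/ffunP => v; rewrite !sigE.
by have [vW|vW] := boolP (v \in W); [rewrite h|rewrite hx ?mulr0].
Qed.

Section Sign.
Variable s : V -> bool.
Hypothesis sD : forall u v, s (u :+: v) = s u (+) s v (+) pol b u v.

Lemma sign_set0 : s set0 = false.
Proof. by rewrite -(symdd set0) sD addbb pol0l. Qed.

Lemma sig1 : sig s 1 = 1.
Proof. by rewrite -mon0 sig_mon sign_set0 expr0 scale1r. Qed.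

(** Exchanging two monomials costs the sign of [pol b], which is exactly the defect of additivity of
    [s]. *)
Lemma sigM x y : sig s (x * y) = sig s y * sig s x.
Proof.
apply/ffunP => C; rewrite sigE !tw_mulE mulr_sumr.
rewrite (reindex_inj (@symdI _ C)) /=; apply: eq_bigr => u _.
have -> : u :+: C :+: C = u by rewrite symdKr.
rewrite !sigE; have -> : s C = s u (+) s (u :+: C) (+) pol b u (u :+: C).
  by rewrite -sD symdK.
rewrite /pol; case: (s u); case: (s _); case: (b u _); case: (b _ u);
  rewrite /= ?expr0 ?expr1; ring.
Qed.

(** Moving [mon P] past [mon v] costs the sign of [pol b v P]; thus altering [s] by a linear form
    amounts to conjugating by a monomial. *)
Lemma sig_pol P x : sig s x * mon P =
  mon P * sig (fun v => s v (+) pol b v P) x.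
Proof.
rewrite (tw_monE x) !(big_morph (sig _) (sigD _) (_ : sig _ 0 = 0)) ?mulr_suml ?mulr_sumr;
  try by apply/ffunP => v; rewrite !ffunE mulr0.
apply: eq_bigr => v _; rewrite !sigZ !sig_mon.
rewrite -!(tw_scalerAl, tw_scalerAr) mon_comm; congr (_ *: _).
by rewrite scalerA signr_addb.
Qed.

End Sign.

(** The anti-involution sending each monomial to its inverse; it becomes (conjugate) transposition
    in the matrix models. *)
Definition star := sig (qf b).

(** Right multiplication in the monomial basis; square matrices then make one-sided inverses
    two-sided ([tw_mul1C]). *)
Definition regmx x : 'M[R]_#|{set 'I_n}| :=
  \matrix_(i, j) (mon (enum_val i) * x) (enum_val j).

Lemma regmxM x y : regmx (x * y) = regmx x *m regmx y.
Proof.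
apply/matrixP => i j; rewrite !mxE mulrA {1}(tw_monE (mon (enum_val i) * x)).
rewrite mulr_suml sum_ffunE (reindex _ (onW_bij _ (@enum_val_bij V))) /=.
by apply: eq_bigr => k _; rewrite -tw_scalerAl tw_scaleE !mxE.
Qed.

Lemma regmx1 : regmx 1 = 1%:M.
Proof.
by apply/matrixP => i j; rewrite !mxE mulr1 ffunE (inj_eq enum_val_inj) eq_sym.
Qed.

Lemma regmx_inj : injective regmx.
Proof.
move=> x y /matrixP h; apply/ffunP => v.
have := h (enum_rank set0) (enum_rank v).
by rewrite !mxE !enum_rankK mon0 !mul1r.
Qed.

Lemma tw_mul1C x y : x * y = 1 -> y * x = 1.
Proof.
move=> h; apply: regmx_inj; rewrite regmx1 regmxM; apply: mulmx1C.
by rewrite -regmxM h regmx1.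
Qed.

Definition nrm x := \sum_v `|x v|.

Lemma nrm_ge0 x : 0 <= nrm x. Proof. exact: sumr_ge0. Qed.
Lemma nrm_coord x v : `|x v| <= nrm x.
Proof. by rewrite /nrm (bigD1 v) //= lerDl sumr_ge0. Qed.
Lemma nrmD x y : nrm (x + y) <= nrm x + nrm y.
Proof. by rewrite -big_split; apply: ler_sum => v _; rewrite ffunE ler_normD. Qed.
Lemma nrm0 : nrm 0 = 0.
Proof. by rewrite /nrm big1 // => v _; rewrite tw_0E normr0. Qed.
Lemma nrmZ a x : nrm (a *: x) = `|a| * nrm x.
Proof. by rewrite /nrm mulr_sumr; apply: eq_bigr => v _; rewrite tw_scaleE normrM. Qed.
Lemma nrm_sum (I : finType) (F : I -> A) : nrm (\sum_i F i) <= \sum_i nrm (F i).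
Proof.
apply: (big_ind2 (fun x r => nrm x <= r)) => //; first by rewrite nrm0.
by move=> x1 r1 x2 r2 h1 h2; apply: le_trans (nrmD _ _) (lerD h1 h2).
Qed.
Lemma nrmM x y : nrm (x * y) <= nrm x * nrm y.
Proof.
rewrite /nrm mulr_suml; apply: le_trans (_ : \sum_C \sum_u `|x u| * `|y (u :+: C)| <= _).
  apply: ler_sum => C _; rewrite tw_mulE; apply: le_trans (ler_norm_sum _ _ _) _.
  by apply: ler_sum => u _; rewrite !normrM normrX normrN1 expr1n mul1r.
rewrite exchange_big /=; apply: ler_sum => u _.
by rewrite [X in _ * X](reindex_inj (@symd_inj _ u)) mulr_sumr.
Qed.

(** Inversion is locally Lipschitz: [w' - u' = u' * (u - w) * w'], and closeness of [w] to [u] first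
    forces [nrm w' <= 2 * nrm u']. *)
Lemma nrm_inv_lip (u u' w w' : A) : u * u' = 1 -> u' * u = 1 -> w * w' = 1 -> 
  nrm (u - w) * nrm u' <= 2^-1 -> nrm (w' - u') <= 2 * nrm u' ^+ 2 * nrm (u - w).
Proof.
move=> uu' u'u ww' h.
have e : w' - u' = u' * (u - w) * w' by rewrite mulrBr mulrBl u'u mul1r -mulrA ww' mulr1.
have le1 : nrm (w' - u') <= nrm u' * nrm (u - w) * nrm w'.
  rewrite e; apply: le_trans (nrmM _ _) _; apply: ler_wpM2r; first exact: nrm_ge0.
  exact: nrmM.
have le2 : nrm w' <= nrm u' + nrm (w' - u') by rewrite -{1}(subrKC u' w') nrmD.
have := nrm_ge0 u'; have := nrm_ge0 w'; have := nrm_ge0 (u - w).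
move: h le1 le2; move: (nrm (u - w)) (nrm u') (nrm w') (nrm (w' - u')).
move=> d a c r h le1 le2 d0 c0 a0.
have c2 : 0 <= 2 * a - c by nra.
have := mulr_ge0 (mulr_ge0 a0 d0) c2; rewrite expr2; lra.
Qed.

End TwistedAlgebra.

(** * Matrix representations of split subspaces *)

Section MatrixRep.
Local Open Scope ring_scope.
Variables (R : realType) (n : nat) (b : bich n).
Local Notation V := {set 'I_n}.
Local Notation "A :+: B" := (symd A B) (at level 50, left associativity).
Local Notation A := (tw R b).
Local Notation mon := (@mon R n b).
Implicit Types (W : {set V}) (u v w : V).

Lemma perp_decomp W x y v : subsp W -> x \in W -> y \in W -> pol b x y -> v \in W ->
  exists2 w, w \in perp b W x y & exists s t,
    v = w :+: ((if s then x else set0) :+: (if t then y else set0)).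
Proof.
move=> hW xW yW xy vW.
pose c := (if pol b v y then x else set0) :+: (if pol b v x then y else set0).
exists (v :+: c); last first.
  by exists (pol b v y), (pol b v x); rewrite -/c symdKr.
have cW : c \in W by rewrite /c; do 2!case: ifP => _; rewrite subspK //; apply: hW.1.
apply/perpP; rewrite subspK //; split=> //; rewrite !polDl.
  by case: (pol b v y); case: (pol b v x);
    rewrite ?polvv ?pol0l ?[pol b y x]polC ?xy.
by case: (pol b v x); case: (pol b v y); rewrite ?polvv ?pol0l ?xy.
Qed.

(** Used with [I] the image of a representation, to show that it contains every monomial of [W]. *)
Lemma perp_ind (I : A -> Prop) W x y : subsp W -> x \in W -> y \in W -> pol b x y ->
  (forall a z, I z -> I (a *: z)) -> (forall z z', I z -> I z' -> I (z * z')) ->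
  I (mon x) -> I (mon y) -> (forall w, w \in perp b W x y -> I (mon w)) ->
  forall v, v \in W -> I (mon v).
Proof.
move=> hW xW yW xy IZ IM Ix Iy Iw v vW.
have Iadd u u' : I (mon u) -> I (mon u') -> I (mon (u :+: u')).
  move=> h h'; rewrite -[mon _](signrZK (b u u')) -monM; apply: IZ; exact: IM.
have I0 : I (mon set0) by apply: Iw; exact: (subsp_perp _ _ _ hW).1.
have [w wP [s [t ->]]] := perp_decomp hW xW yW xy vW.
by apply: (Iadd _ _ (Iw w wP)); apply: Iadd; case: ifP.
Qed.

(** An isomorphism of real matrices, with transposition, onto the subalgebra supported on [W];
    surjectivity is recorded on monomials only. *)
Record mxrep W m (th : 'M[R]_m -> A) : Prop := MxRep {
  mxrepP : forall a M N, th (a *: M + N) = a *: th M + th N;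
  mxrep1 : th 1%:M = 1;
  mxrepM : forall M N, th (M *m N) = th M * th N;
  mxrepT : forall M, th M^T = star (th M);
  mxrep_inj : forall M, th M = 0 -> M = 0;
  mxrep_sup : forall M, sup W (th M);
  mxrep_mon : forall w, w \in W -> exists M, th M = mon w }.

Section Theory.
Variables (W : {set V}) (m : nat) (th : 'M[R]_m -> A) (hth : mxrep W th).

Lemma mxrepD M N : th (M + N) = th M + th N.
Proof. by rewrite -[M]scale1r (mxrepP hth) !scale1r. Qed.
Lemma mxrep0 : th 0 = 0.
Proof. by apply: (addrI (th 0)); rewrite -mxrepD !addr0. Qed.
Lemma mxrepZ a M : th (a *: M) = a *: th M.
Proof. by rewrite -[a *: M]addr0 (mxrepP hth) mxrep0 addr0. Qed.
Lemma mxrepN M : th (- M) = - th M.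
Proof. by rewrite -!scaleN1r mxrepZ. Qed.
Lemma mxrepB M N : th (M - N) = th M - th N.
Proof. by rewrite mxrepD mxrepN. Qed.
Lemma mxrep_delta M : th M = \sum_i \sum_j M i j *: th (delta_mx i j).
Proof.
rewrite {1}(matrix_sum_delta M) (big_morph th mxrepD mxrep0); apply: eq_bigr => i _.
by rewrite (big_morph th mxrepD mxrep0); apply: eq_bigr => j _; rewrite mxrepZ.
Qed.
End Theory.

Lemma star_mon v : star (mon v) = (-1) ^+ qf b v *: mon v.
Proof. exact: sig_mon. Qed.
Lemma starM (x y : A) : star (x * y) = star y * star x.
Proof. by apply: sigM => u v; exact: qfD. Qed.
Lemma starD (x y : A) : star (x + y) = star x + star y. Proof. exact: sigD. Qed.
Lemma starZ a (x : A) : star (a *: x) = a *: star x. Proof. exact: sigZ. Qed.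
Lemma star1 : star (1 : A) = 1.
Proof. by apply: sig1 => u v; exact: qfD. Qed.
Lemma mon_sqr v : mon v * mon v = (-1) ^+ qf b v.
Proof. by rewrite monM symdd mon0 scaler_sign -/(qf b v); case: (qf b v). Qed.

Lemma mxrep_trivial : mxrep [set set0] (fun M : 'M[R]_1 => (M 0 0)%:A : A).
Proof.
split.
- by move=> a M N; rewrite !mxE scalerDl scalerA.
- by rewrite mxE scale1r.
- by move=> M N; rewrite mxE big_ord1 -tw_scalerAl mul1r scalerA.
- by move=> M; rewrite mxE starZ star1.
- move=> M /eqP; rewrite scaler_eq0 oner_eq0 orbF => /eqP h.
  by apply/matrixP => i j; rewrite !ord1 h mxE.
- by move=> M; apply: supZ; apply: sup_mon; rewrite inE.
- by move=> w /set1P ->; exists 1%:M; rewrite mxE scale1r.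
Qed.

Section Doubling.
Variables (W : {set V}) (x y : V) (m : nat) (th : 'M[R]_m -> A).
Hypotheses (hW : subsp W) (xW : x \in W) (yW : y \in W) (xy : pol b x y).
Hypotheses (qx : qf b x = false) (qy : qf b y = false).
Hypothesis hth : mxrep (perp b W x y) th.

Let X := mon x.
Let Y := mon y.
(** [X] and [Y] anticommute and square to 1, so these four elements are matrix units of a copy of 2
    by 2 real matrices. They commute with the image of [th], which makes the doubled algebra a
    tensor product; [star] fixes [X] and [Y], hence transposes the units. *)
Let E11 : A := 2^-1 *: (1 + X).
Let E22 : A := 2^-1 *: (1 - X).
Let E12 := E11 * Y.
Let E21 := E22 * Y.

Let XX : X * X = 1. Proof. by rewrite mon_sqr qx. Qed.
Let YY : Y * Y = 1. Proof. by rewrite mon_sqr qy. Qed.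
Let YX : Y * X = - (X * Y).
Proof. by rewrite /X /Y mon_comm polC xy expr1 scaleN1r. Qed.
Let YE1 : Y * E11 = E22 * Y.
Proof. by rewrite /E11 /E22 -tw_scalerAr -tw_scalerAl mulrDr mulrBl YX mulr1 mul1r. Qed.
Let YE2 : Y * E22 = E11 * Y.
Proof. by rewrite /E11 /E22 -tw_scalerAr -tw_scalerAl mulrBr mulrDl YX mulr1 mul1r opprK. Qed.
Let half2 (z : A) : 2^-1 *: (z + z) = z.
Proof. by rewrite -mulr2n -scaler_nat scalerA mulVf ?scale1r ?pnatr_eq0. Qed.
Let E11E11 : E11 * E11 = E11.
Proof.
rewrite {1}/E11 -tw_scalerAl mulrDl mul1r [X * _](_ : _ = E11) ?half2 //.
by rewrite /E11 -tw_scalerAr mulrDr mulr1 XX addrC.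
Qed.
Let XE22 : X * E22 = - E22.
Proof. by rewrite /E22 -tw_scalerAr mulrBr mulr1 XX -scalerN opprB. Qed.
Let E11E22 : E11 * E22 = 0.
Proof. by rewrite {1}/E11 -tw_scalerAl mulrDl mul1r XE22 subrr scaler0. Qed.
Let E22E22 : E22 * E22 = E22.
Proof. by rewrite {1}/E22 -tw_scalerAl mulrBl mul1r XE22 opprK half2. Qed.
Let E22E11 : E22 * E11 = 0.
Proof.
rewrite {1}/E22 -tw_scalerAl mulrBl mul1r [X * _](_ : _ = E11) ?subrr ?scaler0 //.
by rewrite /E11 -tw_scalerAr mulrDr mulr1 XX addrC.
Qed.
Let E11D22 : E11 + E22 = 1.
Proof. by rewrite /E11 /E22 -scalerDr addrACA subrr addr0 half2. Qed.

Let Eprod := (E11E11, E22E22, E11E22, E22E11, mulr0, mul0r).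
Let E11E12 : E11 * E12 = E12. Proof. by rewrite /E12 mulrA !Eprod. Qed.
Let E11E21 : E11 * E21 = 0. Proof. by rewrite /E21 mulrA !Eprod. Qed.
Let E12E11 : E12 * E11 = 0. Proof. by rewrite /E12 -mulrA YE1 mulrA !Eprod. Qed.
Let E12E12 : E12 * E12 = 0.
Proof. by rewrite /E12 mulrA -(mulrA E11) YE1 mulrA !Eprod. Qed.
Let E12E21 : E12 * E21 = E11.
Proof. by rewrite /E12 /E21 mulrA -(mulrA E11) YE2 mulrA !Eprod -mulrA YY mulr1. Qed.
Let E12E22 : E12 * E22 = E12. Proof. by rewrite /E12 -mulrA YE2 mulrA !Eprod. Qed.
Let E21E11 : E21 * E11 = E21. Proof. by rewrite /E21 -mulrA YE1 mulrA !Eprod. Qed.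
Let E21E12 : E21 * E12 = E22.
Proof. by rewrite /E12 /E21 mulrA -(mulrA E22) YE1 mulrA !Eprod -mulrA YY mulr1. Qed.
Let E21E21 : E21 * E21 = 0.
Proof. by rewrite /E21 mulrA -(mulrA E22) YE2 mulrA !Eprod. Qed.
Let E21E22 : E21 * E22 = 0. Proof. by rewrite /E21 -mulrA YE2 mulrA !Eprod. Qed.
Let E22E12 : E22 * E12 = 0. Proof. by rewrite /E12 mulrA !Eprod. Qed.
Let E22E21 : E22 * E21 = E21. Proof. by rewrite /E21 mulrA !Eprod. Qed.
Let Etable := (E11E12, E11E21, E12E11, E12E12, E12E21, E12E22, E21E11, E21E12,
  E21E21, E21E22, E22E12, E22E21, Eprod).

Let cX M : th M * X = X * th M.
Proof. by apply: (sup_commute (mxrep_sup hth M)) => w /perpP[]. Qed.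
Let cY M : th M * Y = Y * th M.
Proof. by apply: (sup_commute (mxrep_sup hth M)) => w /perpP[]. Qed.
Let c11 M : E11 * th M = th M * E11.
Proof. by rewrite /E11 -tw_scalerAl -tw_scalerAr mulrDl mulrDr cX mul1r mulr1. Qed.
Let c22 M : E22 * th M = th M * E22.
Proof. by rewrite /E22 -tw_scalerAl -tw_scalerAr mulrBl mulrBr cX mul1r mulr1. Qed.
Let c12 M : E12 * th M = th M * E12.
Proof. by rewrite /E12 -mulrA -cY mulrA c11 mulrA. Qed.
Let c21 M : E21 * th M = th M * E21.
Proof. by rewrite /E21 -mulrA -cY mulrA c22 mulrA. Qed.

Definition double_rep (M : 'M[R]_(m + m)) : A :=
  th (ulsubmx M) * E11 + th (ursubmx M) * E12 +
  th (dlsubmx M) * E21 + th (drsubmx M) * E22.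

Let dE p q r s : double_rep (block_mx p q r s) =
  th p * E11 + th q * E12 + th r * E21 + th s * E22.
Proof.
by rewrite /double_rep block_mxKul block_mxKur block_mxKdl block_mxKdr.
Qed.

Let mulE E F M N : E * th N = th N * E -> th M * E * (th N * F) = th (M *m N) * (E * F).
Proof. by move=> c; rewrite (mxrepM hth) -!mulrA [E * (_ * _)]mulrA c -!mulrA. Qed.
Let mul1E E z M : E * th M = th M * E -> E * (th M * z) = th M * (E * z).
Proof. by move=> c; rewrite mulrA c mulrA. Qed.
Let p11 F M N : th M * E11 * (th N * F) = th (M *m N) * (E11 * F).
Proof. exact: mulE. Qed.
Let p12 F M N : th M * E12 * (th N * F) = th (M *m N) * (E12 * F).
Proof. exact: mulE. Qed.
Let p21 F M N : th M * E21 * (th N * F) = th (M *m N) * (E21 * F).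
Proof. exact: mulE. Qed.
Let p22 F M N : th M * E22 * (th N * F) = th (M *m N) * (E22 * F).
Proof. exact: mulE. Qed.
Let m11 z M : E11 * (th M * z) = th M * (E11 * z). Proof. exact: mul1E. Qed.
Let m12 z M : E12 * (th M * z) = th M * (E12 * z). Proof. exact: mul1E. Qed.
Let m21 z M : E21 * (th M * z) = th M * (E21 * z). Proof. exact: mul1E. Qed.
Let m22 z M : E22 * (th M * z) = th M * (E22 * z). Proof. exact: mul1E. Qed.

Let starX : star X = X. Proof. by rewrite star_mon qx expr0 scale1r. Qed.
Let starY : star Y = Y. Proof. by rewrite star_mon qy expr0 scale1r. Qed.
Let starE11 : star E11 = E11.
Proof. by rewrite /E11 starZ starD star1 starX. Qed.
Let starE22 : star E22 = E22.
Proof. by rewrite /E22 starZ starD -scaleN1r starZ star1 starX. Qed.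
Let starE12 : star E12 = E21.
Proof. by rewrite starM starE11 starY YE1. Qed.
Let starE21 : star E21 = E12.
Proof. by rewrite starM starE22 starY YE2. Qed.
Let th0 := mxrep0 hth.
Let th1 := mxrep1 hth.

(** A prescribed isotropic vector is realised as diag(1,-1); this is the source of the split form
    [qeta]. *)
Lemma double_rep_X : double_rep (block_mx 1%:M 0 0 (- 1%:M)) = mon x.
Proof.
rewrite dE (mxrepN hth) th1 th0 !mul0r mul1r mulN1r !addr0.
by rewrite /E11 /E22 -scalerBr opprD addrACA subrr add0r opprK half2.
Qed.

Let double_rep_Y : double_rep (block_mx 0 1%:M 1%:M 0) = mon y.
Proof.
by rewrite dE th1 th0 !mul0r !mul1r add0r addr0 /E12 /E21 -mulrDl E11D22 mul1r.
Qed.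

Let supE11 : sup W E11.
Proof. by apply/supZ/supD; apply: sup_mon => //; exact: hW.1. Qed.
Let supE22 : sup W E22.
Proof.
apply/supZ/supD; first by apply: sup_mon; exact: hW.1.
by rewrite -scaleN1r; apply/supZ/sup_mon.
Qed.

Let addr_shuffle4 (S : nmodType) (p q r s p' q' r' s' : S) :
  p + p' + (q + q') + (r + r') + (s + s') = p + q + r + s + (p' + q' + r' + s').
Proof. by do 3![rewrite [RHS]addrACA; congr (_ + _)]. Qed.

Let addr_shuffle8 (S : nmodType) (p q r s p' q' r' s' : S) :
  p + q + r + s + p' + q' + r' + s' = p + r + q + s + p' + r' + q' + s'.
Proof.
congr (_ + _); rewrite [RHS]addrAC; congr (_ + _ + _ + _ + _); exact: addrAC.
Qed.

Let double_repM M N : double_rep (M *m N) = double_rep M * double_rep N.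
Proof.
rewrite -(submxK M) -(submxK N) mulmx_block !dE !(mxrepD hth).
clearbody E21 E12 E22 E11.
rewrite ![in RHS](mulrDl, mulrDr) !(p11, p12, p21, p22) !Etable !addr0 !add0r.
rewrite !mulrDl !addrA.
exact: addr_shuffle8.
Qed.

Lemma double_rep_mxrep : mxrep W double_rep.
Proof.
split.
- move=> a M N; rewrite -(submxK M) -(submxK N) scale_block_mx add_block_mx !dE !(mxrepP hth) !mulrDl -!tw_scalerAl !scalerDr.
  exact: addr_shuffle4.
- by rewrite scalar_mx_block dE th1 th0 !mul0r !mul1r !addr0 E11D22.
- exact: double_repM.
- move=> M; rewrite -(submxK M) tr_block_mx !dE !starD.
  rewrite (starM (th _) E11) (starM (th _) E12) (starM (th _) E21) (starM (th _) E22).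
  rewrite starE11 starE12 starE21 starE22 -!(mxrepT hth) c11 c12 c21 c22.
  by apply: (congr1 (fun z => z + _)); exact: addrAC.
- move=> M; rewrite -(submxK M) dE.
  set p := ulsubmx M; set q := ursubmx M; set r := dlsubmx M; set s := drsubmx M.
  (* Sandwiching [Z] between matrix units isolates each block, once times [E11] and once times
     [E22]; these two units add up to 1. *)
  move=> h; pose Z := th p * E11 + th q * E12 + th r * E21 + th s * E22.
  have key F G : F * Z * G = 0 by rewrite /Z h mulr0 mul0r.
  have e11 := key E11 E11; have e11' := key E21 E12.
  have e12 := key E11 E21; have e12' := key E21 E22.
  have e21 := key E12 E11; have e21' := key E22 E12.
  have e22 := key E12 E21; have e22' := key E22 E22.
  clearbody E21 E12 E22 E11.
  move: e11 e11' e12 e12' e21 e21' e22 e22'.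
  rewrite /Z !(mulrDl, mulrDr) -!mulrA !(m11, m12, m21, m22) !Etable.
  rewrite !addr0 !add0r.
  have fin M' : th M' * E11 = 0 -> th M' * E22 = 0 -> M' = 0.
    by move=> h1 h2; apply: (mxrep_inj hth); rewrite -[th _]mulr1 -E11D22 mulrDr h1 h2 addr0.
  move=> e11 e11' e12 e12' e21 e21' e22 e22'.
  by rewrite (fin p) // (fin q) // (fin r) // (fin s) // block_mx0.
- move=> M; have supth N : sup W (th N) by apply: supS (mxrep_sup hth N) => w /perpP[].
  have supY : sup W Y by exact: sup_mon.
  by apply: supD; [apply: supD; [apply: supD|]|]; repeat apply: supM.
- have imZ a z : (exists M, double_rep M = z) -> exists M, double_rep M = a *: z.
    move=> [M <-]; exists (a *: M).
    by rewrite -(submxK M) scale_block_mx !dE !(mxrepZ hth) -!tw_scalerAl !scalerDr.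
  have imM z z' : (exists M, double_rep M = z) -> (exists M, double_rep M = z') ->
    exists M, double_rep M = z * z'.
    by move=> [M <-] [N <-]; exists (M *m N); rewrite double_repM.
  apply: (perp_ind hW xW yW xy imZ imM).
  + by exists (block_mx 1%:M 0 0 (- 1%:M)); exact: double_rep_X.
  + by exists (block_mx 0 1%:M 1%:M 0); exact: double_rep_Y.
  + move=> w /(mxrep_mon hth)[M <-]; exists (block_mx M 0 0 M).
    by rewrite dE th0 !mul0r !addr0 -mulrDr E11D22 mulr1.
Qed.

End Doubling.

End MatrixRep.

(** * Quaternionic matrix models *)

Section QuaternionRep.
Local Open Scope ring_scope.
Variables (R : realType) (n : nat) (b : bich n).
Local Notation V := {set 'I_n}.
Local Notation "A :+: B" := (symd A B) (at level 50, left associativity).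
Local Notation A := (tw R b).
Local Notation mon := (@mon R n b).
Implicit Types (W : {set V}) (u v w : V).

Lemma gam_perp_gt0 W x y : subsp W -> x \in W -> y \in W -> pol b x y ->
  qf b x = false -> qf b y = false -> (0 < gam (perp b W x y) (qf b)) = (0 < gam W (qf b)).
Proof.
move=> hW xW yW xy qx qy; rewrite (gam_perp hW xW yW xy) qx qy.
by rewrite pmulr_lgt0.
Qed.

Lemma gam_perp_lt0 W x y : subsp W -> x \in W -> y \in W -> pol b x y ->
  qf b x = false -> qf b y = false -> (gam (perp b W x y) (qf b) < 0) = (gam W (qf b) < 0).
Proof.
move=> hW xW yW xy qx qy; rewrite (gam_perp hW xW yW xy) qx qy.
by rewrite pmulr_llt0.
Qed.

Lemma gam_perp_quat W i j : subsp W -> i \in W -> j \in W -> pol b i j ->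
  qf b i -> qf b j -> (0 < gam (perp b W i j) (qf b)) = (gam W (qf b) < 0).
Proof.
move=> hW iW jW ij qi qj; rewrite (gam_perp hW iW jW ij) qi qj.
by rewrite nmulr_llt0.
Qed.

(** A positive Gauss sum provides a hyperbolic plane as long as [W] is nonzero, and the complement
    has again a positive sum; each plane doubles the matrix size. *)
Lemma split_rep k W : subsp W -> nondeg b W -> 0 < gam W (qf b) -> #|W| = (4 ^ k)%N ->
  exists th : 'M[R]_(2 ^ k) -> A, mxrep W th.
Proof.
elim: k W => [|k IHk] W hW nd g cW.
  have -> : W = [set set0].
    by apply/eqP; rewrite eq_sym eqEcard sub1set hW.1 cards1 cW.
  by eexists; exact: mxrep_trivial.
have [|x [xW x0 qx]] := isotropic_exists hW g.
  by rewrite cW expnS (leq_trans _ (leq_mul (leqnn 4) (_ : 0 < 4 ^ k)%N)) // expn_gt0.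
have [y [yW qy xy]] := hyperbolic_mate hW nd xW x0 qx.
have [||||th hth] := IHk (perp b W x y).
- exact: subsp_perp.
- exact: nondeg_perp.
- by rewrite gam_perp_gt0.
- by have := card_perp hW xW yW xy; rewrite cW expnS => /eqP; rewrite eqn_pmul2l // => /eqP.
by rewrite expnS mul2n -addnn; exists (double_rep x y th); exact: double_rep_mxrep.
Qed.

Lemma split_rep_isotropic k W x : subsp W -> nondeg b W -> 0 < gam W (qf b) ->
  #|W| = (4 ^ k.+1)%N -> x \in W -> x != set0 -> qf b x = false ->
  exists2 th : 'M[R]_(2 ^ k + 2 ^ k) -> A, mxrep W th &
    th (block_mx 1%:M 0 0 (- 1%:M)) = mon x.
Proof.
move=> hW nd g cW xW x0 qx.
have [y [yW qy xy]] := hyperbolic_mate hW nd xW x0 qx.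
have [||||th hth] := @split_rep k (perp b W x y).
- exact: subsp_perp.
- exact: nondeg_perp.
- by rewrite gam_perp_gt0.
- by have := card_perp hW xW yW xy; rewrite cW expnS => /eqP; rewrite eqn_pmul2l // => /eqP.
by exists (double_rep x y th); [exact: double_rep_mxrep|exact: double_rep_X hth].
Qed.

(** The quaternionic analogue of [mxrep]. The clause [qrep_coord] expresses real linearity through
    coordinates, which also yields continuity. *)
Record qrep W m (Th : qmx R m -> A) : Prop := QRep {
  qrepM : forall M N, Th (qmul M N) = Th M * Th N;
  qrep1 : Th (qone R m) = 1;
  qrep_adj : forall M, Th (qadj M) = star (Th M);
  qrep_inj : injective Th;
  qrep_sup : forall M, sup W (Th M);
  qrep_mon : forall w, w \in W -> exists M, Th M = mon w;
  qrep_coord : exists T : 'I_4 * ('I_m * 'I_m) -> A,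
    forall M, Th M = \sum_c qcoord M c *: T c }.

Section Extension.
Variables (W : {set V}) (i j : V) (m : nat) (th : 'M[R]_m -> A).
Hypotheses (hW : subsp W) (iW : i \in W) (jW : j \in W) (ij : pol b i j).
Hypotheses (qi : qf b i) (qj : qf b j).
Hypothesis hth : mxrep (perp b W i j) th.

Let I := mon i.
Let J := mon j.
Let K := I * J.

(** [I] and [J] anticommute, square to -1 and commute with the image of [th], so with [K] they act
    as quaternion units over it. *)
Definition quat_rep (M : qmx R m) : A :=
  th (q0 M) + th (q1 M) * I + th (q2 M) * J + th (q3 M) * K.

Let II : I * I = -1. Proof. by rewrite mon_sqr qi. Qed.
Let JJ : J * J = -1. Proof. by rewrite mon_sqr qj. Qed.
Let JI : J * I = - K.
Proof. by rewrite /K /I /J mon_comm polC ij expr1 scaleN1r. Qed.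
Let IJ : I * J = K. Proof. by []. Qed.
Let IK : I * K = - J. Proof. by rewrite mulrA II mulN1r. Qed.
Let KJ : K * J = - I. Proof. by rewrite -mulrA JJ mulrN1. Qed.
Let JK : J * K = I. Proof. by rewrite mulrA JI mulNr KJ opprK. Qed.
Let KI : K * I = J. Proof. by rewrite -mulrA JI mulrN IK opprK. Qed.
Let KK : K * K = -1. Proof. by rewrite {1}/K -mulrA JK II. Qed.
Let table := (II, JJ, KK, IJ, JI, IK, KI, JK, KJ).

Let cI M : I * th M = th M * I.
Proof. by apply/esym/(sup_commute (mxrep_sup hth M)) => w /perpP[]. Qed.
Let cJ M : J * th M = th M * J.
Proof. by apply/esym/(sup_commute (mxrep_sup hth M)) => w /perpP[]. Qed.
Let cK M : K * th M = th M * K.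
Proof. by rewrite /K -mulrA cJ mulrA cI mulrA. Qed.
Let cIm M z : I * (th M * z) = th M * (I * z). Proof. by rewrite mulrA cI mulrA. Qed.
Let cJm M z : J * (th M * z) = th M * (J * z). Proof. by rewrite mulrA cJ mulrA. Qed.
Let cKm M z : K * (th M * z) = th M * (K * z). Proof. by rewrite mulrA cK mulrA. Qed.

Let quat_repM M N : quat_rep (qmul M N) = quat_rep M * quat_rep N.
Proof.
rewrite /quat_rep -/I -/J -/K /=; clearbody K J I; rewrite !(mxrepB hth, mxrepD hth, mxrepM hth).
rewrite [RHS]mulrDl [X in _ = X + _]mulrDl [X in _ = X + _ + _]mulrDl !mulrDr -!mulrA.
rewrite !(cI, cJ, cK, cIm, cJm, cKm, table) !(mulrN, mulrN1) .
rewrite !mulrDl !mulNr -!mulrA !mulr1.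
repeat match goal with |- context [th ?x * ?y] => move: (th x * y) => ? end.
by apply/ffunP => v; rewrite !(tw_addE, tw_oppE); ring.
Qed.

Let starI : star I = - I. Proof. by rewrite star_mon qi expr1 scaleN1r. Qed.
Let starJ : star J = - J. Proof. by rewrite star_mon qj expr1 scaleN1r. Qed.
Let starK : star K = - K. Proof. by rewrite starM starI starJ mulrNN JI. Qed.

Let quat_rep_adj M : quat_rep (qadj M) = star (quat_rep M).
Proof.
rewrite /quat_rep -/I -/J -/K !starD !(starM (th _)) starI starJ starK /=.
by rewrite !(mxrepN hth) -!(mxrepT hth) !(mulNr, cI, cJ, cK).
Qed.

Let quat_repB M N : quat_rep M - quat_rep N = th (q0 M - q0 N) + th (q1 M - q1 N) * I +
  th (q2 M - q2 N) * J + th (q3 M - q3 N) * K.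
Proof.
rewrite /quat_rep -/I -/J -/K !(mxrepB hth) !mulrBl.
by apply/ffunP => v; rewrite !(tw_addE, tw_oppE); ring.
Qed.

Let dbl (z : A) : z + z = 0 -> z = 0.
Proof.
move=> h; apply/ffunP => v; have := congr1 (fun t : A => t v) h.
by rewrite /= tw_addE tw_0E; lra.
Qed.

(** Multiplying by [J] on both sides negates the first term and keeps the second; [quat0] separates
    the pairs (1, I) and (J, K) in the same way with [I]. *)
Let compl0 p q : th p + th q * I = 0 -> p = 0 /\ q = 0.
Proof.
move=> h; have h' : J * (th p + th q * I) * J = 0 by rewrite h mulr0 mul0r.
move: h'; clearbody K J I; rewrite mulrDr mulrDl -!mulrA !(cJm, table) => h'.
rewrite mulrN1 in h'.
have q0 : th q = 0.
  have : th q * I = 0 by apply: dbl; rewrite -[RHS]addr0 -{1}h -h' addrACA subrr add0r.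
  by move/(congr1 (fun z => z * I)); rewrite mul0r -mulrA II mulrN1 => /eqP; rewrite oppr_eq0 => /eqP.
by move: h; rewrite q0 mul0r addr0; split; apply: (mxrep_inj hth).
Qed.

Let quat0 p q r s : th p + th q * I + th r * J + th s * K = 0 ->
  [/\ p = 0, q = 0, r = 0 & s = 0].
Proof.
set z := _ + _ => h; have h' : I * z * I = 0 by rewrite h mulr0 mul0r.
have {}h' : - th p - th q * I + th r * J + th s * K = 0.
  move: h'; rewrite /z; clearbody K J I; rewrite !mulrDr !mulrDl -!mulrA !(cIm, table).
  by rewrite !(mulrN, mulrN1, mulr1, table) ?opprK.
have [p0 q0'] : p = 0 /\ q = 0.
  apply: compl0; apply: dbl.
  transitivity (z - (- th p - th q * I + th r * J + th s * K)); last by rewrite h h' subrr.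
  rewrite /z; move: (th p) (th q * I) (th r * J) (th s * K) => ? ? ? ?.
  by apply/ffunP => v; rewrite !(tw_addE, tw_oppE); ring.
have [r0 s0] : r = 0 /\ s = 0.
  apply: compl0.
  have e : (th r + th s * I) * J = 0.
    apply: dbl; rewrite mulrDl -mulrA IJ.
    transitivity (z + (- th p - th q * I + th r * J + th s * K)); last by rewrite h h' addr0.
    rewrite /z; move: (th p) (th q * I) (th r * J) (th s * K) => ? ? ? ?.
    by apply/ffunP => v; rewrite !(tw_addE, tw_oppE); ring.
  have := congr1 (fun t => - (t * J)) e.
  by rewrite /= mul0r oppr0 -mulrA JJ mulrN1 opprK.
by [].
Qed.

Lemma quat_rep_qrep : qrep W quat_rep.
Proof.
have supth N : sup W (th N) by apply: supS (mxrep_sup hth N) => w /perpP[].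
have supI : sup W I by exact: sup_mon.
have supJ : sup W J by exact: sup_mon.
split.
- exact: quat_repM.
- by rewrite /quat_rep /= (mxrep1 hth) (mxrep0 hth) !mul0r !addr0.
- exact: quat_rep_adj.
- move=> [a0 a1 a2 a3] [c0 c1 c2 c3] /eqP; rewrite -subr_eq0 quat_repB /= => /eqP /quat0[].
  by move=> /eqP + /eqP + /eqP + /eqP; rewrite !subr_eq0 => /eqP-> /eqP-> /eqP-> /eqP->.
- by move=> M; apply: supD; [apply: supD; [apply: supD|]|]; repeat apply: supM.
- have imZ a z : (exists M, quat_rep M = z) -> exists M, quat_rep M = a *: z.
    move=> [M <-]; exists (QM (a *: q0 M) (a *: q1 M) (a *: q2 M) (a *: q3 M)).
    by rewrite /quat_rep /= !(mxrepZ hth) -!tw_scalerAl !scalerDr.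
  have imM z z' : (exists M, quat_rep M = z) -> (exists M, quat_rep M = z') ->
    exists M, quat_rep M = z * z'.
    by move=> [M <-] [N <-]; exists (qmul M N); rewrite quat_repM.
  apply: (perp_ind hW iW jW ij imZ imM).
  + exists (QM 0 1%:M 0 0).
    by rewrite /quat_rep /= (mxrep1 hth) (mxrep0 hth) !mul0r !addr0 add0r mul1r.
  + exists (QM 0 0 1%:M 0).
    by rewrite /quat_rep /= (mxrep1 hth) (mxrep0 hth) !mul0r !addr0 !add0r mul1r.
  + move=> w /(mxrep_mon hth)[M <-]; exists (QM M 0 0 0).
    by rewrite /quat_rep /= (mxrep0 hth) !mul0r !addr0.
- exists (fun c : 'I_4 * ('I_m * 'I_m) => th (delta_mx c.2.1 c.2.2) * nth 1 [:: 1; I; J; K] c.1) => M.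
  rewrite -(pair_bigA _ (fun (c : 'I_4) (st : 'I_m * 'I_m) => qcoord M (c, st) *: (th (delta_mx st.1 st.2) * nth 1 [:: 1; I; J; K] c))) /=.
  have e (N : 'M[R]_m) z : th N * z = \sum_(st : 'I_m * 'I_m) N st.1 st.2 *: (th (delta_mx st.1 st.2) * z).
    rewrite (mxrep_delta hth N) mulr_suml -(pair_bigA _ (fun s t => N s t *: (th (delta_mx s t) * z))) /=.
    by apply: eq_bigr => s _; rewrite mulr_suml; apply: eq_bigr => t _; rewrite tw_scalerAl.
  by rewrite !big_ord_recl big_ord0 /= addr0 /qcoord /= -!e mulr1 !addrA.
Qed.

Lemma quat_rep_q0 a : quat_rep (QM a 0 0 0) = th a.
Proof. by rewrite /quat_rep /= (mxrep0 hth) !mul0r !addr0. Qed.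

Lemma quat_rep_qiI : quat_rep (qiI R m) = mon i.
Proof. by rewrite /quat_rep /= (mxrep1 hth) (mxrep0 hth) !mul0r !addr0 add0r mul1r. Qed.

End Extension.

End QuaternionRep.

(** * Lie group isomorphisms *)

Section LieIso.
Local Open Scope ring_scope.
Local Notation coord := Defs.coord.
Variable R : realType.

Lemma cont_on_lin (G H : mgrp R) (f : car G -> car H) (c : idx G -> idx H -> R) :
  (forall x, gset G x -> forall j, coord H (f x) j = \sum_i c i j * coord G x i) ->
  cont_on G H f.
Proof.
move=> hf x Gx eps eps0.
pose C := 1 + \sum_i \sum_j `|c i j|.
have C0 : 0 < C by rewrite ltr_pwDl // sumr_ge0 // => i _; exact: sumr_ge0.
exists (eps / C) => [|y Gy hy j]; first exact: divr_gt0.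
rewrite !hf // -sumrB.
apply: le_lt_trans (_ : \sum_i `|c i j| * (eps / C) < eps).
  apply: le_trans (ler_norm_sum _ _ _) _; apply: ler_sum => i _.
  by rewrite -mulrBr normrM ler_wpM2l // ltW.
rewrite -mulr_suml mulrCA gtr_pMr // ltr_pdivrMr // mul1r /C ltr_pwDl //.
by apply: ler_sum => i _; rewrite (bigD1 j) //= lerDl sumr_ge0.
Qed.

Lemma cont_on_comp (G H K : mgrp R) (f : car G -> car H) (g : car H -> car K) :
  (forall x, gset G x -> gset H (f x)) -> cont_on G H f -> cont_on H K g ->
  cont_on G K (fun x => g (f x)).
Proof.
move=> fGH fc gc x Gx eps eps0.
have [d d0 hd] := gc (f x) (fGH x Gx) eps eps0.
have [e e0 he] := fc x Gx d d0.
by exists e => // y Gy hy; apply: hd; [exact: fGH|exact: he].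
Qed.

Lemma lie_iso_trans (G H K : mgrp R) : lie_iso G H -> lie_iso H K -> lie_iso G K.
Proof.
move=> [f [g [fG gH gf fg [fM fc gc]]]] [f' [g' [fH gK gf' fg' [fM' fc' gc']]]].
exists (fun x => f' (f x)), (fun z => g (g' z)); split.
- by move=> x /fG/fH.
- by move=> z /gK/gH.
- by move=> x Gx; rewrite gf' ?gf //; exact: fG.
- by move=> z Kz; rewrite fg ?fg' //; exact: gK.
split.
- by move=> x y Gx Gy; rewrite fM // fM' //; exact: fG.
- exact: cont_on_comp fG fc fc'.
- exact: cont_on_comp gK gc' gc.
Qed.

Lemma cont_on_dup (G H : mgrp R) (f : car G -> car H) : cont_on G H f ->
  cont_on (dupG G) (dupG H) (fun x => (f x.1, f x.2)).
Proof.
move=> fc [x1 x2] [/= G1 G2] eps eps0.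
have [d1 d10 h1] := fc x1 G1 eps eps0.
have [d2 d20 h2] := fc x2 G2 eps eps0.
exists (Num.min d1 d2); first by rewrite lt_min d10.
move=> [y1 y2] [/= Gy1 Gy2] hy [] j /=.
- by apply: h1 => // i; have := hy (inl i); rewrite lt_min => /andP[].
- by apply: h2 => // i; have := hy (inr i); rewrite lt_min => /andP[].
Qed.

Lemma lie_iso_dup (G H : mgrp R) : lie_iso G H -> lie_iso (dupG G) (dupG H).
Proof.
move=> [f [g [fG gH gf fg [fM fc gc]]]].
exists (fun x => (f x.1, f x.2)), (fun y => (g y.1, g y.2)); split.
- by move=> [x y] [/fG ? /fG ?].
- by move=> [x y] [/gH ? /gH ?].
- by move=> [x y] [/= ? ?]; rewrite !gf.
- by move=> [x y] [/= ? ?]; rewrite !fg.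
split; [|exact: cont_on_dup|exact: cont_on_dup].
by move=> [x y] [x' y'] [/= ? ?] [/= ? ?]; rewrite !fM.
Qed.

Variables (n : nat) (b : bich n).
Local Notation V := {set 'I_n}.
Local Notation "A :+: B" := (symd A B) (at level 50, left associativity).
Local Notation A := (tw R b).
Local Notation mon := (@mon R n b).
Implicit Types (W : {set V}) (u v w : V).

Definition twgrp (P : A -> Prop) : mgrp R :=
  @MGrp R A V (fun x v => x v) (fun x y => x * y) P.

Definition TG W (s : V -> bool) : mgrp R :=
  twgrp (fun x => sup W x /\ sig s x * x = 1).

Lemma cont_on_tw (P Q : A -> Prop) (f : A -> A) :
  (forall a x y, f (a *: x + y) = a *: f x + f y) -> cont_on (twgrp P) (twgrp Q) f.
Proof.
move=> fP; have fD x y : f (x + y) = f x + f y by rewrite -[x]scale1r fP !scale1r.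
have f0 : f 0 = 0 by apply: (addrI (f 0)); rewrite -fD !addr0.
have fZ a x : f (a *: x) = a *: f x by rewrite -[a *: x]addr0 fP f0 addr0.
apply: (@cont_on_lin (twgrp P) (twgrp Q) f (fun v w => f (mon v) w)) => x _ w /=.
rewrite {1}(tw_monE x) (big_morph f fD f0) sum_ffunE; apply: eq_bigr => v _.
by rewrite fZ tw_scaleE mulrC.
Qed.

Section Rep.
Variables (W : {set V}) (m : nat) (Th : qmx R m -> A).
Hypotheses (hW : subsp W) (hTh : qrep W Th).

(** Preimages of the monomials of [W] are chosen and extended linearly, so the inverse is visibly
    linear in coordinates. *)
Lemma qrep_inverse : exists Psi : A -> qmx R m,
  (forall x, sup W x -> Th (Psi x) = x) /\
  exists c : V -> 'I_4 * ('I_m * 'I_m) -> R,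
    forall x j, qcoord (Psi x) j = \sum_w c w j * x w.
Proof.
have [Mw hMw] : exists Mw : V -> qmx R m, forall w, w \in W -> Th (Mw w) = mon w.
  apply: (@fin_all_exists V (fun _ => qmx R m) (fun w M => w \in W -> Th M = mon w)) => w.
  have [wW|wW] := boolP (w \in W); last by exists (qone R m).
  by have [M <-] := qrep_mon hTh wW; exists M.
pose Psi (x : A) := QM (\sum_(w in W) x w *: q0 (Mw w)) (\sum_(w in W) x w *: q1 (Mw w))
  (\sum_(w in W) x w *: q2 (Mw w)) (\sum_(w in W) x w *: q3 (Mw w)).
have PsiE x c : qcoord (Psi x) c = \sum_(w in W) x w * qcoord (Mw w) c.
  case: c => [[[|[|[|[|?]]]] ?] [i j]] //; rewrite /qcoord /= summxE;
  by apply: eq_bigr => w _; rewrite mxE.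
exists Psi; split.
  move=> x hx; have [T hT] := qrep_coord hTh; rewrite hT.
  under eq_bigr => c _ do rewrite PsiE scaler_suml.
  rewrite exchange_big /= [RHS](sup_sum hx); apply: eq_bigr => w wW.
  by rewrite -hMw // hT scaler_sumr; apply: eq_bigr => c _; rewrite scalerA.
exists (fun w j => if w \in W then qcoord (Mw w) j else 0) => x j.
rewrite PsiE [RHS](bigID [in W]) /= [X in _ = _ + X]big1 ?addr0.
  by apply: eq_bigr => w ->; rewrite mulrC.
by move=> w /negbTE ->; rewrite mul0r.
Qed.

Lemma TG_mkQ (P : qmx R m -> Prop) s : (forall M, P M <-> sig s (Th M) * Th M = 1) ->
  lie_iso (TG W s) (mkQ R m P).
Proof.
move=> hP; have [Psi [ThPsi [c hc]]] := qrep_inverse.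
have [T hT] := qrep_coord hTh.
have PsiTh M : Psi (Th M) = M.
  by apply: (qrep_inj hTh); rewrite ThPsi //; exact: qrep_sup hTh M.
exists Psi, Th; split => /=.
- by move=> x [hx ex]; apply/hP; rewrite ThPsi.
- by move=> M /hP ex; split=> //; exact: qrep_sup hTh M.
- by move=> x [hx _]; exact: ThPsi.
- by move=> M _; exact: PsiTh.
split.
- move=> x y [hx _] [hy _]; apply: (qrep_inj hTh).
  by rewrite (qrepM hTh) !ThPsi //; exact: supM.
- by apply: cont_on_lin => x _ j; exact: hc.
- apply: (@cont_on_lin (mkQ R m P) (TG W s) Th (fun c v => T c v)) => M _ v /=.
  by rewrite hT sum_ffunE; apply: eq_bigr => j _; rewrite tw_scaleE mulrC.
Qed.

Lemma qinvertibleP M : qinvertible M <-> exists2 y, sup W y & y * Th M = 1.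
Proof.
split=> [[N [_ NM]]|[y hy yM]].
  by exists (Th N); [exact: qrep_sup hTh N|rewrite -(qrepM hTh) NM (qrep1 hTh)].
have [Psi [ThPsi _]] := qrep_inverse.
exists (Psi y); split; apply: (qrep_inj hTh); rewrite (qrepM hTh) (qrep1 hTh) ThPsi //.
exact: tw_mul1C.
Qed.

(** By [sig_pol], [star x * mon P = mon P * sig s x]; cancelling the unit [mon P] turns invariance
    of the form [F] into [sig s x * x = 1]. *)
Lemma qform_group s P F : P \in W -> Th F = mon P ->
  (forall w, w \in W -> s w = qf b w (+) pol b w P) -> forall M,
  (qinvertible M /\ qmul (qadj M) (qmul F M) = F) <-> sig s (Th M) * Th M = 1.
Proof.
move=> PW ThF hs M; set x := Th M.
have hx : sup W x := qrep_sup hTh M.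
have key : Th (qmul (qadj M) (qmul F M)) = mon P * (sig s x * x).
  rewrite !(qrepM hTh) (qrep_adj hTh) ThF !mulrA; congr (_ * _).
  by rewrite /star sig_pol (eq_sig hx hs).
have unitP : mon P * ((-1) ^+ qf b P *: mon P) = 1.
  by rewrite -tw_scalerAr mon_sqr scaler_sign; case: (qf b P); rewrite ?opprK.
split=> [[_ /(congr1 Th)]|e].
  rewrite key ThF => /(congr1 (fun z => (-1) ^+ qf b P *: mon P * z)) /=.
  by rewrite !mulrA (tw_mul1C unitP) mul1r.
split; last by apply: (qrep_inj hTh); rewrite key e mulr1.
by apply/qinvertibleP; exists (sig s x) => //; exact: sig_sup.
Qed.

End Rep.
End LieIso.

(** * Groups of a nondegenerate form with negative Gauss sum *)

Section Nondegenerate.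
Local Open Scope ring_scope.
Variables (R : realType) (n : nat) (b : bich n).
Local Notation V := {set 'I_n}.
Local Notation "A :+: B" := (symd A B) (at level 50, left associativity).
Local Notation A := (tw R b).
Local Notation mon := (@mon R n b).
Implicit Types (i j u v w x y P : V).
Variable (W : {set V}).
Hypotheses (hW : subsp W) (nd : nondeg b W) (gamW : gam W (qf b) < 0).

Lemma quaternion_split i j : i \in W -> j \in W -> qf b i -> qf b j -> pol b i j ->
  [/\ subsp (perp b W i j), nondeg b (perp b W i j),
      0 < gam (perp b W i j) (qf b) & #|W| = (4 * #|perp b W i j|)%N].
Proof.
move=> iW jW qi qj ij; split; [exact: subsp_perp|exact: nondeg_perp| |exact: card_perp].
by rewrite gam_perp_quat.
Qed.

Lemma qrep_imaginary k i : #|W| = (4 ^ k.+1)%N -> i \in W -> qf b i ->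
  exists2 Th : qmx R (2 ^ k) -> A, qrep W Th & Th (qiI R _) = mon i.
Proof.
move=> cW iW qi; have [j [jW qj ij]] := quaternion_mate hW nd gamW iW qi.
have [hW' nd' gW' cW'] := quaternion_split iW jW qi qj ij.
have [|th hth] := @split_rep R n b k _ hW' nd' gW'.
  by move: cW'; rewrite cW expnS => /eqP; rewrite eqn_pmul2l // => /eqP.
by exists (quat_rep i j th); [exact: quat_rep_qrep|exact: quat_rep_qiI hth].
Qed.

Lemma qrep_exists k : #|W| = (4 ^ k.+1)%N -> exists Th : qmx R (2 ^ k) -> A, qrep W Th.
Proof.
move=> cW; have [i iW qi] := gam_lt0 gamW.
by have [Th hTh _] := qrep_imaginary cW iW qi; exists Th.
Qed.

(** The complement of a hyperbolic plane through [x] still has negative Gauss sum, so quaternion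
    units can be chosen orthogonal to [x]. Then [x] lies in the split part, where it is realised as
    diag(1,-1). *)
Lemma qrep_isotropic k x : #|W| = (4 ^ k.+2)%N -> x \in W -> x != set0 -> qf b x = false ->
  exists2 Th : qmx R (2 ^ k + 2 ^ k) -> A, qrep W Th & Th (qeta R _ _) = mon x.
Proof.
move=> cW xW x0 qx; have [y [yW qy xy]] := hyperbolic_mate hW nd xW x0 qx.
have gp : gam (perp b W x y) (qf b) < 0 by rewrite gam_perp_lt0.
have [i /[dup] iW' /perpP[iW ix iy] qi] := gam_lt0 gp.
have [j [/perpP[jW jx jy] qj ij]] :=
  quaternion_mate (subsp_perp b x y hW) (nondeg_perp hW xW yW xy nd) gp iW' qi.
have [hW' nd' gW' cW'] := quaternion_split iW jW qi qj ij.
have [||th hth thX] := @split_rep_isotropic R n b k _ x hW' nd' gW' _ _ x0 qx.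
- by move: cW'; rewrite cW expnS => /eqP; rewrite eqn_pmul2l // => /eqP.
- by apply/perpP; rewrite ![pol b x _]polC.
exists (quat_rep i j th); first exact: quat_rep_qrep.
rewrite /qeta (quat_rep_q0 hth) -thX; congr th.
apply/matrixP => s t; rewrite -[s]splitK -[t]splitK.
case: (split s) => s'; case: (split t) => t' /=.
- by rewrite block_mxEul !mxE /= ltn_ord (inj_eq (@lshift_inj _ _)).
- by rewrite block_mxEur !mxE /= eq_lrshift mulr0n.
- by rewrite block_mxEdl !mxE /= eq_rlshift mulr0n.
- by rewrite block_mxEdr !mxE /= ltnNge leq_addr /= (inj_eq (@rshift_inj _ _)) mulNrn.
Qed.

Variable s : V -> bool.
Hypothesis sD : forall u v, s (u :+: v) = s u (+) s v (+) pol b u v.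

(** Two quadratic forms with the same polar form differ by a linear form, which is represented since
    [W] is nondegenerate. *)
Lemma sign_represented : exists2 P, P \in W & forall w, w \in W -> s w = qf b w (+) pol b w P.
Proof.
have [|P PW hP] := @char_represented n b W (fun v => s v (+) qf b v) hW nd.
  move=> u v _ _; rewrite sD qfD.
  by case: (s u); case: (s v); case: (qf b u); case: (qf b v); case: (pol b u v).
by exists P => // w /hP <-; rewrite addbCA addbb addbF.
Qed.

Lemma TG_Sp k : #|W| = (4 ^ k.+1)%N -> (forall w, w \in W -> s w = qf b w) ->
  lie_iso (TG R b W s) (SpH R (2 ^ k)).
Proof.
move=> cW hs; have [Th hTh] := qrep_exists cW.
apply: (TG_mkQ hW hTh) => M.
have hF := @qform_group R n b W _ Th hTh s set0 (qone R _) (hW.1) (qrep1 hTh) _ M.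
rewrite -hF; last by move=> w wW; rewrite pol0r addbF hs.
have -> : qmul (qone R (2 ^ k)) M = M.
  by apply: (qrep_inj hTh); rewrite (qrepM hTh) (qrep1 hTh) mul1r.
by [].
Qed.

(** Opposite Gauss signs of [s] and [qf b] force [qf b P], so [P] can serve as the quaternion unit
    i. *)
Lemma TG_OH k : #|W| = (4 ^ k.+1)%N -> 0 < gam W s -> lie_iso (TG R b W s) (OH R (2 ^ k)).
Proof.
move=> cW gs; have [P PW hP] := sign_represented.
have qP : qf b P.
  apply: contraTT gs; rewrite (gam_pol hW PW hP) => /negbTE ->.
  by rewrite expr0 mul1r -leNgt ltW.
have [Th hTh ThP] := qrep_imaginary cW PW qP.
by apply: (TG_mkQ hW hTh) => M; exact: qform_group ThP hP M.
Qed.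

(** Equal Gauss signs make [P] isotropic, and [s] differing from [qf b] makes it nonzero. *)
Lemma TG_SpRS k : #|W| = (4 ^ k.+2)%N -> gam W s < 0 ->
  (exists2 w, w \in W & s w != qf b w) ->
  lie_iso (TG R b W s) (SpRS R (2 ^ k) (2 ^ k)).
Proof.
move=> cW gs [w wW sw]; have [P PW hP] := sign_represented.
have P0 : P != set0.
  by apply: contraNneq sw => P0; rewrite hP // P0 pol0r addbF.
have qP : qf b P = false.
  apply/negbTE; apply: contraTN gs; rewrite (gam_pol hW PW hP) => ->.
  by rewrite expr1 mulN1r oppr_lt0 -leNgt ltW.
have [Th hTh ThP] := qrep_isotropic cW PW P0 qP.
by apply: (TG_mkQ hW hTh) => M; exact: qform_group ThP hP M.
Qed.

End Nondegenerate.

(** * Splitting by a central monomial of square one *)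

Section Radical.
Local Open Scope ring_scope.
Variables (R : realType) (n : nat) (b : bich n).
Local Notation V := {set 'I_n}.
Local Notation "A :+: B" := (symd A B) (at level 50, left associativity).
Local Notation A := (tw R b).
Local Notation mon := (@mon R n b).
Implicit Types (u v w : V) (x y : A).
Variables (V0 : {set V}) (om : V) (l : V -> bool).
Hypotheses (hV0 : subsp V0) (omV : om \in V0) (lom : l om).
Hypothesis lD : forall u v, l (u :+: v) = l u (+) l v.
Hypotheses (om_central : forall v, v \in V0 -> pol b v om = false) (qom : qf b om = false).

Local Notation W := (hyperplane V0 l).
Let hW : subsp W := subsp_hyperplane hV0 lD.
Let supW0 x : sup W x -> sup V0 x. Proof. by apply: supS => w; exact: hyperplane_sub. Qed.

Let z := mon om.
(** [ep] and [em] are complementary orthogonal idempotents, central among elements supported on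
    [V0]. *)
Let ep : A := 2^-1 *: (1 + z).
Let em : A := 2^-1 *: (1 - z).

Let zz : z * z = 1. Proof. by rewrite mon_sqr qom. Qed.
Let cz x : sup V0 x -> x * z = z * x.
Proof. by move=> hx; apply: (sup_commute hx). Qed.
Let half2 x : 2^-1 *: (x + x) = x.
Proof. by rewrite -mulr2n -scaler_nat scalerA mulVf ?scale1r ?pnatr_eq0. Qed.
Let zep : z * ep = ep. Proof. by rewrite -tw_scalerAr mulrDr mulr1 zz addrC. Qed.
Let zem : z * em = - em.
Proof. by rewrite -tw_scalerAr mulrBr mulr1 zz -scalerN opprB. Qed.
Let epD : ep + em = 1. Proof. by rewrite -scalerDr addrACA subrr addr0 half2. Qed.
Let epB : ep - em = z.
Proof. by rewrite -scalerBr opprB [1 + z]addrC addrACA subrr addr0 half2. Qed.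
Let epz : ep * z = ep. Proof. by rewrite -tw_scalerAl mulrDl mul1r zz addrC. Qed.
Let emz : em * z = - em.
Proof. by rewrite -tw_scalerAl mulrBl mul1r zz -scalerN opprB. Qed.
Let ep2 : ep + ep = 1 + z.
Proof. by rewrite -scalerDr half2. Qed.
Let em2 : em + em = 1 - z.
Proof. by rewrite -scalerDr half2. Qed.
Let epep : ep * ep = ep.
Proof. by rewrite {1}/ep -tw_scalerAl mulrDl mul1r zep half2. Qed.
Let emem : em * em = em.
Proof. by rewrite {1}/em -tw_scalerAl mulrBl mul1r zem opprK half2. Qed.
Let epem : ep * em = 0.
Proof. by rewrite {1}/ep -tw_scalerAl mulrDl mul1r zem subrr scaler0. Qed.
Let emep : em * ep = 0.
Proof. by rewrite {1}/em -tw_scalerAl mulrBl mul1r zep subrr scaler0. Qed.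
Let cep x : sup V0 x -> ep * x = x * ep.
Proof. by move=> hx; rewrite /ep -tw_scalerAl -tw_scalerAr mulrDl mulrDr cz ?mul1r ?mulr1. Qed.
Let cem x : sup V0 x -> em * x = x * em.
Proof. by move=> hx; rewrite /em -tw_scalerAl -tw_scalerAr mulrBl mulrBr cz ?mul1r ?mulr1. Qed.

Definition restr x : A := [ffun w => if w \in W then x w else 0].

Lemma restrE x w : restr x w = if w \in W then x w else 0.
Proof. by rewrite ffunE. Qed.
Lemma restrP a x y : restr (a *: x + y) = a *: restr x + restr y.
Proof.
apply/ffunP => w; rewrite tw_addE tw_scaleE !ffunE.
by case: ifP; rewrite ?mulr0 ?addr0.
Qed.
Lemma restr_sup x : sup W (restr x).
Proof. by move=> w /negbTE wW; rewrite ffunE wW. Qed.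

Let restr_id x : sup W x -> restr x = x.
Proof. by move=> hx; apply/ffunP => w; rewrite ffunE; case: ifP => // /negbT /hx ->. Qed.
Let restr_z x : sup W x -> restr (x * z) = 0.
Proof.
move=> hx; apply/ffunP => w; rewrite restrE tw_0E; case: ifP => // wW.
rewrite mulr_monE hx ?mulr0 //; move: wW; rewrite !inE lD lom addbT => /andP[_ ->].
by rewrite andbF.
Qed.
Let restrD x : sup V0 x -> x = restr x + restr (x * z) * z.
Proof.
move=> hx; apply/ffunP => v; rewrite tw_addE mulr_monE !restrE.
have [vV|vV] := boolP (v \in V0); last first.
  by rewrite hx // !inE (subspKr hV0) // (negbTE vV) mulr0 addr0.
rewrite !inE subspKr // vV lD lom addbT /= negbK; case: (l v) => /=; last by rewrite mulr0 addr0.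
rewrite -[z]/(mon om) mulr_monE symdKr add0r mulrA.
have -> : b (v :+: om) om = b v om by rewrite bbDl -[b om om]/(qf b om) qom addbF.
by rewrite -signr_addb addbb expr0 mul1r.
Qed.

Definition join (x : A * A) : A := x.1 * ep + x.2 * em.
(** Writing [x = r + t * z] with [r], [t] supported on the hyperplane ([restrD]), the two components
    are [r + t] and [r - t], the values of [x] at [z = 1] and [z = -1]. *)
Definition splitp x := restr (x + x * z).
Definition splitm x := restr (x - x * z).

Let restr_add x y : restr (x + y) = restr x + restr y.
Proof. by rewrite -[x]scale1r restrP !scale1r. Qed.
Let restr_opp x : restr (- x) = - restr x.
Proof.
have r0 : restr 0 = 0 by apply/ffunP => w; rewrite !ffunE; case: ifP.
by rewrite -[- x]addr0 -scaleN1r restrP r0 addr0 scaleN1r.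
Qed.

Lemma joinK x : sup V0 x -> join (splitp x, splitm x) = x.
Proof.
move=> hx; rewrite /join /splitp /splitm /= !restr_add restr_opp.
have := restrD hx; set r := restr x; set t := restr (x * z) => ->.
rewrite mulrDl mulrBl addrACA -mulrDr epD mulr1 -mulrBr epB.
by [].
Qed.

Lemma splitpK x1 x2 : sup W x1 -> sup W x2 -> splitp (join (x1, x2)) = x1.
Proof.
move=> h1 h2; rewrite /splitp /join /=.
have -> : x1 * ep + x2 * em + (x1 * ep + x2 * em) * z = x1 + x1 * z.
  by rewrite mulrDl -!mulrA epz emz mulrN addrACA subrr addr0 -mulrDr ep2 mulrDr mulr1.
by rewrite restr_add restr_z // addr0 restr_id.
Qed.

Lemma splitmK x1 x2 : sup W x1 -> sup W x2 -> splitm (join (x1, x2)) = x2.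
Proof.
move=> h1 h2; rewrite /splitm /join /=.
have -> : x1 * ep + x2 * em - (x1 * ep + x2 * em) * z = x2 - x2 * z.
  by rewrite mulrDl -!mulrA epz emz mulrN opprD opprK addrACA subrr add0r -mulrDr em2 mulrBr mulr1.
by rewrite restr_add restr_opp restr_z // oppr0 addr0 restr_id.
Qed.

Let sup_ep : sup V0 ep.
Proof. by apply/supZ/supD; apply: sup_mon => //; exact: hV0.1. Qed.
Let sup_em : sup V0 em.
Proof.
apply/supZ/supD; first by apply: sup_mon; exact: hV0.1.
by rewrite -scaleN1r; apply/supZ/sup_mon.
Qed.

Lemma join_sup p : sup W p.1 -> sup W p.2 -> sup V0 (join p).
Proof. by move=> h1 h2; apply: supD; apply: supM => //; exact: supW0. Qed.

Lemma joinM p q : sup W q.1 -> sup W q.2 ->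
  join p * join q = join (p.1 * q.1, p.2 * q.2).
Proof.
move=> /supW0 h1 /supW0 h2; rewrite /join /= mulrDl !mulrDr -!mulrA.
rewrite !(mulrA ep) !(mulrA em) !cep // !cem // -!mulrA epep emem epem emep.
by rewrite !mulr0 addr0 add0r.
Qed.

Lemma join1 : join (1, 1) = 1.
Proof. by rewrite /join !mul1r epD. Qed.

Let sup1 : sup W (1 : A). Proof. by apply: sup_mon; exact: hW.1. Qed.

Lemma join_eq1 p : sup W p.1 -> sup W p.2 -> join p = 1 <-> p = (1, 1).
Proof.
case: p => p1 p2 /= h1 h2; split=> [e|->]; last exact: join1.
move: (splitpK h1 h2) (splitmK h1 h2).
have p1E : splitp 1 = 1 by rewrite -{1}join1 splitpK.
have m1E : splitm 1 = 1 by rewrite -{1}join1 splitmK.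
by rewrite e p1E m1E => <- <-.
Qed.

Variable s : V -> bool.
Hypothesis sD : forall u v, s (u :+: v) = s u (+) s v (+) pol b u v.

Let sig_z : sig s z = (-1) ^+ s om *: z. Proof. exact: sig_mon. Qed.

Lemma sig_join_fixed p : s om = false -> sup W p.1 -> sup W p.2 ->
  sig s (join p) = join (sig s p.1, sig s p.2).
Proof.
move=> som /supW0 h1 /supW0 h2; rewrite /join sigD !(sigM sD) /=.
have -> : sig s ep = ep by rewrite sigZ sigD (sig1 R sD) sig_z som expr0 scale1r.
have -> : sig s em = em.
  by rewrite sigZ sigD (sig1 R sD) -scaleN1r sigZ sig_z som expr0 scale1r scaleN1r.
by rewrite cep ?cem //; exact: sig_sup.
Qed.

(** Here [sig s] negates [z], hence exchanges [ep] and [em]. *)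
Lemma sig_join_swap p : s om -> sup W p.1 -> sup W p.2 ->
  sig s (join p) = join (sig s p.2, sig s p.1).
Proof.
move=> som /supW0 h1 /supW0 h2; rewrite /join sigD !(sigM sD) /= addrC.
have -> : sig s ep = em by rewrite sigZ sigD (sig1 R sD) sig_z som expr1 scaleN1r.
have -> : sig s em = ep.
  by rewrite sigZ sigD (sig1 R sD) -scaleN1r sigZ sig_z som expr1 !scaleN1r opprK.
by rewrite cep ?cem //; exact: sig_sup.
Qed.

Lemma splitpP a x y : splitp (a *: x + y) = a *: splitp x + splitp y.
Proof. by rewrite /splitp mulrDl -tw_scalerAl -restrP scalerDr addrACA. Qed.
Lemma splitmP a x y : splitm (a *: x + y) = a *: splitm x + splitm y.
Proof.
by rewrite /splitm mulrDl -tw_scalerAl -restrP scalerBr opprD addrACA.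
Qed.

Lemma TG_dup : s om = false -> lie_iso (TG R b V0 s) (dupG (TG R b W s)).
Proof.
move=> som.
have splitG x : gset (TG R b V0 s) x -> gset (dupG (TG R b W s)) (splitp x, splitm x).
  move=> [hx ex] /=; have hp := @restr_sup (x + x * z); have hm := @restr_sup (x - x * z).
  move: ex; rewrite -{1 2}(joinK hx) sig_join_fixed // joinM // join_eq1 /=; first by case=> -> ->.
    by apply: supM => //; exact: sig_sup.
  by apply: supM => //; exact: sig_sup.
exists (fun x => (splitp x, splitm x)), join; split => //.
- move=> [x1 x2] [[/= h1 e1] [/= h2 e2]]; split; first exact: join_sup.
  by rewrite sig_join_fixed // joinM // e1 e2 join1.
- by move=> x [hx _]; exact: joinK.
- by move=> [x1 x2] [[/= h1 _] [/= h2 _]]; rewrite splitpK ?splitmK.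
split.
- move=> x y [/= hx _] [/= hy _].
  have hp t : sup W (splitp t) by exact: restr_sup.
  have hm t : sup W (splitm t) by exact: restr_sup.
  rewrite -{1 2}(joinK hx) -{1 2}(joinK hy) joinM //= splitpK ?splitmK //; exact: supM.
- move=> x hx eps eps0.
  have [d d0 hd] := @cont_on_tw R n b _ (fun _ => True) splitp splitpP x hx eps eps0.
  have [e e0 he] := @cont_on_tw R n b _ (fun _ => True) splitm splitmP x hx eps eps0.
  exists (Num.min d e); first by rewrite lt_min d0.
  move=> y hy hxy [] v /=.
    by apply: hd => // i; have := hxy i; rewrite lt_min => /andP[].
  by apply: he => // i; have := hxy i; rewrite lt_min => /andP[].
- pose c (t : V + V) v := match t with inl w => (mon w * ep) v | inr w => (mon w * em) v end.
  apply: (@cont_on_lin R (dupG (TG R b W s)) (TG R b V0 s) join c) => [[x1 x2] _ v] /=.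
  rewrite /join /= tw_addE big_sumType /=; congr (_ + _).
    rewrite {1}(tw_monE x1) mulr_suml sum_ffunE; apply: eq_bigr => w _.
    by rewrite -tw_scalerAl tw_scaleE mulrC.
  rewrite {1}(tw_monE x2) mulr_suml sum_ffunE; apply: eq_bigr => w _.
  by rewrite -tw_scalerAl tw_scaleE mulrC.
Qed.

Section GeneralLinear.
Variables (m : nat) (Th : qmx R m -> A).
Hypotheses (hTh : qrep W Th) (som : s om).

(** Inversion as a total map, with value 0 where no left inverse supported on [W] exists. *)
Definition twinv x : A :=
  if pselect (exists y, sup W y /\ y * x = 1) is left h then projT1 (cid h) else 0.

Lemma twinvP x y : sup W y -> y * x = 1 -> [/\ sup W (twinv x), twinv x * x = 1 & twinv x = y].
Proof.
move=> hy yx; rewrite /twinv; case: pselect => [h|[]]; last by exists y.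
case: (cid h) => t [ht tx] /=; split=> //.
by rewrite -[t]mulr1 -(tw_mul1C yx) mulrA tx mul1r.
Qed.

Lemma nrm_sig x : nrm (sig s x) = nrm x.
Proof.
by rewrite /nrm; apply: eq_bigr => v _; rewrite sigE normrM normrX normrN1 expr1n mul1r.
Qed.

Lemma cont_on_GL : cont_on (GLH R m) (TG R b V0 s) (fun M => join (Th M, sig s (twinv (Th M)))).
Proof.
move=> M /(qinvertibleP hTh)[y hy yM] eps eps0.
have [_ iM _] := twinvP hy yM; have Mi := tw_mul1C iM.
have [T hT] := qrep_coord hTh.
set u := Th M in iM Mi *; pose a := nrm (twinv u).
have a0 : 0 <= a := nrm_ge0 _.
pose E := nrm ep + nrm em + 1; pose C := 1 + \sum_c nrm (T c).
have E0 : 0 < E by rewrite ltr_wpDl // addr_ge0 // nrm_ge0.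
have C0 : 0 < C by rewrite ltr_pwDl // sumr_ge0 // => c _; exact: nrm_ge0.
(* The first bound meets the hypothesis of [nrm_inv_lip]; the second keeps the sum of the errors of
   [u] and of its inverse at most [eps / 2]. The constant [C] converts closeness of coordinates into
   closeness in [nrm]. *)
pose d := Num.min (2 * (a + 1))^-1 (eps / (2 * E * (1 + 2 * a ^+ 2))).
have den0 : 0 < 2 * E * (1 + 2 * a ^+ 2).
  by rewrite !mulr_gt0 // ltr_pwDl // mulr_ge0 // exprn_ge0.
have d0 : 0 < d.
  by rewrite lt_min divr_gt0 // invr_gt0 mulr_gt0 // ltr_wpDl.
exists (d / C); first exact: divr_gt0.
move=> M' /(qinvertibleP hTh)[y' hy' yM'] hMM' v.
have [_ iM' _] := twinvP hy' yM'; have Mi' := tw_mul1C iM'.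
set w := Th M' in iM' Mi' *.
have uw : nrm (u - w) <= d.
  have -> : u - w = \sum_c (qcoord M c - qcoord M' c) *: T c.
    by rewrite /u /w !hT -sumrB; apply: eq_bigr => c _; rewrite scalerBl.
  apply: le_trans (_ : \sum_c d / C * nrm (T c) <= _).
    apply: le_trans (nrm_sum _) _; apply: ler_sum => c _; rewrite nrmZ.
    by apply: ler_wpM2r; [exact: nrm_ge0|exact/ltW/hMM'].
  by rewrite -mulr_sumr mulrAC ler_pdivrMr // ler_pM2l // /C lerDr.
have ua : nrm (u - w) * a <= 2^-1.
  have d1 : d <= (2 * (a + 1))^-1 by rewrite ge_min lexx.
  apply: le_trans (ler_wpM2r a0 (le_trans uw d1)) _.
  by rewrite mulrC ler_pdivrMr ?mulr_gt0 ?ltr_wpDl //; lra.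
have iw : nrm (twinv w - twinv u) <= 2 * a ^+ 2 * nrm (u - w) := nrm_inv_lip Mi iM Mi' ua.
rewrite distrC -tw_oppE -tw_addE; apply: le_lt_trans (nrm_coord _ _) _.
have -> : join (w, sig s (twinv w)) - join (u, sig s (twinv u)) =
    - 1 *: (u - w) * ep + sig s (twinv w - twinv u) * em.
  rewrite /join /= sigD -[X in _ + sig s X]scaleN1r sigZ !scaleN1r opprB !mulrDl !mulNr.
  by rewrite opprD addrACA.
apply: le_lt_trans (nrmD _ _) _.
apply: le_lt_trans (_ : d * E + 2 * a ^+ 2 * d * E < eps).
  have ep0 := nrm_ge0 ep; have em0 := nrm_ge0 em.
  apply: lerD; apply: le_trans (nrmM _ _) _.
    rewrite nrmZ normrN1 mul1r; apply: ler_pM => //; try exact: nrm_ge0.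
    by rewrite /E -addrA lerDl addr_ge0.
  rewrite nrm_sig; apply: ler_pM => //; try exact: nrm_ge0.
    by apply: le_trans iw _; rewrite ler_wpM2l // mulr_ge0 // exprn_ge0.
  by rewrite /E addrAC lerDr addr_ge0.
have d2 : d <= eps / (2 * E * (1 + 2 * a ^+ 2)) by rewrite ge_min lexx orbT.
have : d * (2 * E * (1 + 2 * a ^+ 2)) <= eps by rewrite -ler_pdivlMr.
by lra.
Qed.

(** As the two factors are exchanged, the equation for (x1, x2) becomes [sig s x2 * x1 = 1]: [x1] is
    an arbitrary invertible element and determines [x2]. *)
Lemma TG_GL : lie_iso (TG R b V0 s) (GLH R m).
Proof.
have [Psi [ThPsi [c hc]]] := qrep_inverse hTh.
have hp x : sup W (splitp x) by exact: restr_sup.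
have hm x : sup W (splitm x) by exact: restr_sup.
have sig_one : sig s 1 = 1 :> A := sig1 R sD.
have split_inv x : gset (TG R b V0 s) x -> sig s (splitm x) * splitp x = 1.
  move=> [hx ex].
  have : sig s (join (splitp x, splitm x)) * join (splitp x, splitm x) = 1 by rewrite joinK.
  rewrite sig_join_swap /= // joinM /= // join_eq1 /=; first by case.
  - by apply: supM => //; exact: sig_sup.
  - by apply: supM => //; exact: sig_sup.
have GLs M : qinvertible M -> [/\ sup W (twinv (Th M)) & twinv (Th M) * Th M = 1].
  by move/(qinvertibleP hTh) => [y hy yM]; have [? ? _] := twinvP hy yM.
have fG x : gset (TG R b V0 s) x -> gset (GLH R m) (Psi (splitp x)).
  move=> hx; apply/(qinvertibleP hTh); exists (sig s (splitm x)); first exact: sig_sup.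
  by rewrite ThPsi //; exact: split_inv.
exists (fun x => Psi (splitp x)), (fun M => join (Th M, sig s (twinv (Th M)))); split => //.
- move=> M /GLs[hi iM]; have hM := qrep_sup hTh M; have hs := sig_sup s hi.
  split; first exact: join_sup.
  rewrite sig_join_swap // joinM //= sigK iM -(sigM sD) iM sig_one; exact: join1.
- move=> x /[dup] /split_inv xi [hx _]; rewrite ThPsi //.
  by have [_ _ ->] := twinvP (sig_sup s (hm x)) xi; rewrite sigK joinK.
- move=> M /GLs[hi iM]; apply: (qrep_inj hTh).
  by rewrite ThPsi // splitpK //; [exact: qrep_sup hTh M|exact: sig_sup].
split; last exact: cont_on_GL.
- move=> x y [/= hx _] [/= hy _]; apply: (qrep_inj hTh).
  rewrite (qrepM hTh) !ThPsi // -{1}(joinK hx) -{1}(joinK hy) joinM //= splitpK //; exact: supM.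
- apply: (@cont_on_comp R (TG R b V0 s) (@twgrp R n b (fun _ => True)) (GLH R m) splitp Psi) => //.
    by apply: cont_on_tw; exact: splitpP.
  by apply: cont_on_lin => x _ j; exact: hc.
Qed.

End GeneralLinear.

End Radical.

(** * Groups of a form with one-dimensional radical *)

Section RadicalGroups.
Local Open Scope ring_scope.
Variables (R : realType) (n : nat) (b : bich n).
Local Notation V := {set 'I_n}.
Local Notation "A :+: B" := (symd A B) (at level 50, left associativity).
Variables (V0 : {set V}) (om : V) (l : V -> bool).
Hypotheses (hV0 : subsp V0) (omV : om \in V0) (lom : l om).
Hypothesis lD : forall u v, l (u :+: v) = l u (+) l v.
Hypothesis om_central : forall v, v \in V0 -> pol b v om = false.
Hypothesis radV0 : forall w, w \in V0 -> w != set0 -> w != om -> exists2 u, u \in V0 & pol b w u.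
Hypothesis gamV0 : gam V0 (qf b) < 0.

Local Notation W := (hyperplane V0 l).

(** The terms at [w] and [w :+: om] cancel. *)
Lemma gam_radical0 (s : V -> bool) :
  (forall u v, s (u :+: v) = s u (+) s v (+) pol b u v) -> s om -> gam V0 s = 0.
Proof.
move=> sD som; rewrite /gam (hyperplane_sum hV0 omV lom lD) big1 // => w /hyperplane_sub wV.
by rewrite sD som om_central // addbF addbT; case: (s w).
Qed.

Let qom : qf b om = false.
Proof. by apply/negP => /(gam_radical0 (qfD b)) g0; move: gamV0; rewrite g0. Qed.
Let hW : subsp W := subsp_hyperplane hV0 lD.
Let ndW : nondeg b W := nondeg_hyperplane hV0 omV lom lD om_central radV0.
Let gamW : gam W (qf b) < 0.
Proof.
move: gamV0; rewrite (gam_hyperplane hV0 omV lom lD) ?pmulr_rlt0 // => v vV.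
by rewrite qfD qom om_central // !addbF.
Qed.
Let cardW k : #|V0| = (2 * 4 ^ k)%N -> #|W| = (4 ^ k)%N.
Proof. by rewrite (card_hyperplane hV0 omV lom lD) => /eqP; rewrite eqn_pmul2l // => /eqP. Qed.

Variable s : V -> bool.
Hypothesis sD : forall u v, s (u :+: v) = s u (+) s v (+) pol b u v.

Let gamWs : s om = false -> gam V0 s = 2 * gam W s.
Proof.
move=> som; apply: (gam_hyperplane hV0 omV lom lD) => v vV.
by rewrite sD som om_central // !addbF.
Qed.

Lemma TG_dup_Sp k : #|V0| = (2 * 4 ^ k.+1)%N -> (forall w, w \in V0 -> s w = qf b w) ->
  lie_iso (TG R b V0 s) (dupG (SpH R (2 ^ k))).
Proof.
move=> cV hs; have som : s om = false by rewrite hs.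
apply: lie_iso_trans (TG_dup R hV0 omV lom lD om_central qom sD som) _.
apply/lie_iso_dup/TG_Sp => //; first exact: cardW.
by move=> w /hyperplane_sub; exact: hs.
Qed.

Lemma TG_dup_OH k : #|V0| = (2 * 4 ^ k.+1)%N -> 0 < gam V0 s ->
  lie_iso (TG R b V0 s) (dupG (OH R (2 ^ k))).
Proof.
move=> cV gs.
have som : s om = false by apply/negP => /(gam_radical0 sD) g0; rewrite g0 in gs.
apply: lie_iso_trans (TG_dup R hV0 omV lom lD om_central qom sD som) _.
apply/lie_iso_dup/TG_OH => //; first exact: cardW.
by move: gs; rewrite gamWs // pmulr_rgt0.
Qed.

Lemma TG_dup_SpRS k : #|V0| = (2 * 4 ^ k.+2)%N -> gam V0 s < 0 ->
  (exists2 w, w \in V0 & s w != qf b w) ->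
  lie_iso (TG R b V0 s) (dupG (SpRS R (2 ^ k) (2 ^ k))).
Proof.
move=> cV gs [w wV sw].
have som : s om = false by apply/negP => /(gam_radical0 sD) g0; rewrite g0 in gs.
apply: lie_iso_trans (TG_dup R hV0 omV lom lD om_central qom sD som) _.
apply/lie_iso_dup/TG_SpRS => //; first exact: cardW.
  by move: gs; rewrite gamWs // pmulr_rlt0.
(* Translation by [om] changes neither sign, so the disagreement can be moved into the
   hyperplane. *)
have [lw|lw] := boolP (l w); last by exists w; rewrite // inE wV.
exists (w :+: om); first by rewrite inE (subspKr hV0) // wV lD lw lom.
by rewrite sD qfD som qom om_central // !addbF.
Qed.

(** If [s om] were false, [gam V0 s] would be twice a Gauss sum on the hyperplane, which by
    [gam_pol] is nonzero. *)
Lemma TG_radical_GL k : #|V0| = (2 * 4 ^ k.+1)%N -> gam V0 s = 0 ->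
  lie_iso (TG R b V0 s) (GLH R (2 ^ k)).
Proof.
move=> cV gs; have [Th hTh] := @qrep_exists R n b W hW ndW gamW k (cardW cV).
apply: (TG_GL hV0 omV lom lD om_central qom sD hTh).
apply/negP => /negP/negbTE som; move: gs; rewrite gamWs //.
have [P PW hP] := sign_represented hW ndW sD.
rewrite (gam_pol hW PW hP) => /eqP; rewrite !mulf_eq0 signr_eq0 /= => /eqP g0.
by move: gamW; rewrite g0.
Qed.

End RadicalGroups.

(** * Clifford cocycles *)

Section CliffordCocycle.
Variable n : nat.
Local Notation I := 'I_n.
Local Notation V := {set I}.
Local Notation "A :+: B" := (symd A B) (at level 50, left associativity).
Implicit Types (A B C : V) (a c : I).

Lemma odd_card (T : finType) (X : {pred T}) : odd #|X| = \big[addb/false]_x (x \in X).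
Proof.
rewrite -sum1_card (big_morph odd oddD (erefl _)) big_mkcond.
by apply: eq_bigr => x _; case: ifP.
Qed.

Lemma odd_symd A B : odd #|A :+: B| = odd #|A| (+) odd #|B|.
Proof. by rewrite !odd_card -big_split; apply: eq_bigr => x _; exact: in_symd. Qed.

(** The bilinear form over F_2 whose matrix is [r]; identities between forms thus reduce to
    identities between relations. *)
Definition bform (r : rel I) A B :=
  odd #|[set x : I * I | [&& x.1 \in A, x.2 \in B & r x.1 x.2]]|.

Lemma bformE r A B : bform r A B =
  \big[addb/false]_(x : I * I) [&& x.1 \in A, x.2 \in B & r x.1 x.2].
Proof. by rewrite /bform odd_card; apply: eq_bigr => x _; rewrite inE. Qed.

Lemma bformDl r A B C : bform r (A :+: B) C = bform r A C (+) bform r B C.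
Proof.
rewrite !bformE -big_split; apply: eq_bigr => x _; rewrite in_symd.
by case: (_ \in A); case: (_ \in B); case: (_ \in C); case: (r _ _).
Qed.

Lemma bformDr r A B C : bform r C (A :+: B) = bform r C A (+) bform r C B.
Proof.
rewrite !bformE -big_split; apply: eq_bigr => x _; rewrite in_symd.
by case: (_ \in A); case: (_ \in B); case: (_ \in C); case: (r _ _).
Qed.

Lemma bform_addb (r r' : rel I) A B :
  bform (fun a c => r a c (+) r' a c) A B = bform r A B (+) bform r' A B.
Proof.
rewrite !bformE -big_split; apply: eq_bigr => x _.
by case: (_ \in A); case: (_ \in B); case: (r _ _); case: (r' _ _).
Qed.

Lemma eq_bform (r r' : rel I) A B : (forall a c, r a c = r' a c) -> bform r A B = bform r' A B.
Proof. by move=> h; rewrite !bformE; apply: eq_bigr => x _; rewrite h. Qed.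

Lemma bform_swap r A B : bform r B A = bform (fun a c => r c a) A B.
Proof.
rewrite !bformE (reindex_inj (h := fun x : I * I => (x.2, x.1))) /=.
  by apply: eq_bigr => x _; case: (_ \in A); case: (_ \in B).
by move=> [? ?] [? ?] [-> ->].
Qed.

Lemma bform_true A B : bform (fun _ _ => true) A B = odd #|A| && odd #|B|.
Proof.
rewrite -oddM -cardsX /bform; congr (odd _); apply: eq_card => x.
by rewrite !inE andbT.
Qed.

Lemma bform_eq A B : bform eq_op A B = odd #|A :&: B|.
Proof.
rewrite /bform -(card_imset _ (f := fun a : I => (a, a))); last by move=> a c [].
congr (odd _); apply: eq_card => -[a c]; rewrite inE /=.
apply/and3P/imsetP => [[aA cB /eqP ac]|[x + [-> ->]]].
  by exists a; rewrite ?inE ?aA ac.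
by rewrite inE => /andP[-> ->].
Qed.

(* [p] is the number of generators squaring to [e]; the flag [t] multiplies  *)
(* every odd basis element by the imaginary unit.                            *)
Definition clr (p : nat) (t : bool) : rel I :=
  fun a c => ((c < a)%N || (a == c) && (p <= a)%N) (+) t.
Definition bcl p t : bich n := Bich (@bformDl (clr p t)) (@bformDr (clr p t)).

(** [clr] plus its transpose is true off the diagonal and false on it, whatever [p] and [t]: all
    signatures share one polar form. *)
Lemma pol_bcl p t A B : pol (bcl p t) A B = (odd #|A| && odd #|B|) (+) odd #|A :&: B|.
Proof.
rewrite /pol /= (bform_swap _ A) -bform_addb -bform_true -bform_eq -bform_addb.
apply: eq_bform => a c; rewrite /clr [c == a]eq_sym -(inj_eq val_inj) /=.
by case: t; case: ltngtP => [||->] //=; case: (p <= _)%N.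
Qed.

Lemma qf_bcl p t A : qf (bcl p t) A = qf (bcl p false) A (+) (t && odd #|A|).
Proof.
rewrite /qf /=; case: t => /=; last by rewrite addbF.
rewrite -[odd #|A|]andbb -bform_true -bform_addb; apply: eq_bform => a c.
by rewrite /clr addbF.
Qed.

Lemma qf_bcl1 p a : qf (bcl p false) [set a] = (p <= a)%N.
Proof.
rewrite /qf /= bformE (bigD1 (a, a)) //= big1 => [|x xa].
  by rewrite !inE eqxx /clr ltnn eqxx !addbF.
rewrite !inE; case: eqP => // x1; case: eqP => // x2.
by move: xa; rewrite -x1 {2}x1 -x2 -surjective_pairing eqxx.
Qed.

Lemma pol_bcl1 p t A a : pol (bcl p t) A [set a] = odd #|A| (+) (a \in A).
Proof.
rewrite pol_bcl cards1 andbT; congr (_ (+) _).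
have [aA|aA] := boolP (a \in A).
  by rewrite (setIidPr _) ?cards1 // sub1set.
by rewrite (_ : _ :&: _ = set0) ?cards0 //; apply/setP => x; rewrite !inE;
  case: eqP => [->|]; rewrite ?(negbTE aA) ?andbF.
Qed.

End CliffordCocycle.

(** * Gauss sums of Clifford forms as Gaussian integers *)

Section GaussSums.
Local Open Scope ring_scope.
Variables (n p : nat).
Local Notation I := 'I_n.
Local Notation V := {set I}.
Local Notation "A :+: B" := (symd A B) (at level 50, left associativity).
Local Notation f := (qf (bcl n p false)).
Implicit Types (A B : V).

Lemma subsp_powerset (D : V) : subsp (powerset D).
Proof.
split; first by rewrite powersetE sub0set.
move=> A B; rewrite !powersetE => /subsetP hA /subsetP hB; apply/subsetP => x.
rewrite in_symd; have [xA _|xA] := boolP (x \in A); first exact: hA.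
by rewrite /=; exact: hB.
Qed.

Definition evn : {set V} := [set A : V | ~~ odd #|A|].

Lemma subsp_setT : subsp [set: V]. Proof. by split=> *; rewrite inE. Qed.
Lemma subsp_evn : subsp evn.
Proof.
split; first by rewrite inE cards0.
by move=> A B; rewrite !inE odd_symd => /negbTE-> /negbTE->.
Qed.

(* The initial segments of the sums over even ([e = false]) and odd          *)
(* ([e = true]) subsets are the real and imaginary parts of                  *)
(* [(1 + i)^(min p k) (1 - i)^(k - p)] (truncated subtraction).                  *)
Definition psum (e : bool) (k : nat) : int :=
  \sum_(A : V | (A \subset [set a : I | (a < k)%N]) && (odd #|A| == e)) (-1) ^+ f A.

Lemma psum0 e : psum e 0 = (~~ e)%:R.
Proof.
have h (A : V) : (A \subset [set a : I | (a < 0)%N]) = (A == set0).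
  by rewrite (_ : [set a : I | _] = set0) ?subset0 //; apply/setP => a; rewrite !inE.
rewrite /psum; case: e; last first.
  rewrite (big_pred1 set0) ?qf0 // => A; rewrite h /=.
  by case: eqP => // ->; rewrite cards0.
by rewrite big_pred0 // => A; rewrite h; case: eqP => // ->; rewrite cards0.
Qed.

(** A subset containing the new generator is that generator added to a subset of opposite parity;
    the signs are the square of the generator and its polar value with that subset. *)
Lemma psumS e k : (k < n)%N ->
  psum e k.+1 = psum e k + (-1) ^+ (p <= k)%N * (-1) ^+ (~~ e) * psum (~~ e) k.
Proof.
move=> kn; pose a : I := Ordinal kn; set D' := [set c : I | (c < k.+1)%N].
have aD' : [set a] \in powerset D' by rewrite powersetE sub1set inE /=.
have D'E : [set c : I | (c < k)%N] = D' :\ a.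
  by apply/setP => c; rewrite !inE -(inj_eq val_inj) /= ltn_neqAle ltnS.
rewrite {1}/psum (bigID (fun A : V => a \notin A)) /=; congr (_ + _).
  apply: eq_bigl => A; rewrite D'E subsetD1 -!andbA; congr (_ && _).
  by rewrite andbC.
rewrite (reindex_inj (@symdI n [set a])) /psum mulr_sumr /=; apply: eq_big => A.
  rewrite -powersetE (subspKr (subsp_powerset D')) // powersetE D'E subsetD1.
  rewrite odd_symd cards1 addbT in_symd inE eqxx addbT negbK -!andbA; congr (_ && _).
  by rewrite andbC; case: e; case: (odd _).
rewrite odd_symd cards1 in_symd inE eqxx !addbT negbK => /andP[/andP[_ /eqP eA] aA] /=.
rewrite qfD pol_bcl1 qf_bcl1 (negbTE aA) addbF -eA negbK.
by case: (f A); case: (p <= _)%N; case: (odd _).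
Qed.

(** Multiplication of the Gaussian integer [z.1 + i z.2] by [1 - i] if [s], by [1 + i] otherwise. *)
Definition gstep (s : bool) (z : int * int) : int * int :=
  if s then (z.1 + z.2, z.2 - z.1) else (z.1 - z.2, z.2 + z.1).

Fixpoint gpow k := if k is k'.+1 then gstep (p <= k')%N (gpow k') else (1, 0) : int * int.

Lemma psum_gpow k : (k <= n)%N -> (psum false k, psum true k) = gpow k.
Proof.
elim: k => [|k IHk] kn; first by rewrite !psum0.
rewrite !psumS //= -IHk ?(ltnW kn) // /gstep /=.
by case: (p <= k)%N; congr (_, _); rewrite /= ?expr0 ?expr1; lia.
Qed.

Lemma gam_evn : gam evn f = psum false n.
Proof.
apply: eq_bigl => A; rewrite inE eqbF_neg [_ \subset _](_ : _ = true) //.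
by apply/subsetP => a; rewrite inE ltn_ord.
Qed.

Lemma gam_setT t : gam [set: V] (qf (bcl n p t)) = psum false n + (-1) ^+ t * psum true n.
Proof.
have sT (A : V) : (A \subset [set a : I | (a < n)%N]).
  by apply/subsetP => a; rewrite inE ltn_ord.
rewrite /gam (bigID (fun A : V => odd #|A|)) [LHS]addrC; congr (_ + _).
  apply: eq_big => A; first by rewrite inE sT eqbF_neg.
  by move=> /andP[_ /negbTE oA]; rewrite (qf_bcl _ t) oA andbF addbF.
rewrite /psum mulr_sumr; apply: eq_big => A; first by rewrite inE sT eqb_id.
by move=> /andP[_ oA]; rewrite (qf_bcl _ t) oA andbT; case: t; case: (f A).
Qed.

End GaussSums.

(** * Signs of the Gauss sums modulo 8 *)

Section GaussSigns.
Local Open Scope ring_scope.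
Implicit Types (z : int * int).

Lemma gpow_iter p q : gpow p (p + q) = iter q (gstep true) (iter p (gstep false) (1, 0)).
Proof.
elim: q => [|q IHq]; last by rewrite addnS /= leq_addr IHq.
rewrite addn0; suff h k : (k <= p)%N -> gpow p k = iter k (gstep false) (1, 0) by exact: h.
by elim: k => //= k IHk kp; rewrite IHk ?(ltnW kp) // leqNgt kp.
Qed.

Definition gscale (c : int) z := (c * z.1, c * z.2).

Lemma gstep_scale s c z : gstep s (gscale c z) = gscale c (gstep s z).
Proof. by case: s; rewrite /gstep /gscale /=; congr (_, _); ring. Qed.

Lemma iter_gstep_scale s k c z : iter k (gstep s) (gscale c z) = gscale c (iter k (gstep s) z).
Proof. by elim: k => //= k ->; exact: gstep_scale. Qed.

(** Both fourth powers are -4, so eighth powers are the positive scalar 16 and signs depend only on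
    residues modulo 8. *)
Lemma gstep4 s z : iter 4 (gstep s) z = gscale (- 4) z.
Proof.
by case: z => x y; rewrite /gstep /gscale; case: s; cbn [fst snd iter]; congr (_, _); ring.
Qed.

Lemma iter_gstep_mod8 s k z :
  exists2 c, 0 < c & iter k (gstep s) z = gscale c (iter (k %% 8) (gstep s) z).
Proof.
rewrite {1}(divn_eq k 8); elim: (k %/ 8)%N => [|m [c c0 IHm]].
  by exists 1 => //; rewrite /gscale !mul1r -surjective_pairing.
exists (16 * c); first by rewrite mulr_gt0.
rewrite mulSn -addnA (iterD 8) IHm (iterD 4 4) !iter_gstep_scale !gstep4 /gscale.
by cbn [fst snd]; congr (_, _); ring.
Qed.

Lemma gpow_mod8 p q : exists2 c, 0 < c &
  gpow p (p + q) = gscale c (iter (q %% 8) (gstep true) (iter (p %% 8) (gstep false) (1, 0))).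
Proof.
rewrite gpow_iter; have [c c0 ->] := iter_gstep_mod8 false p (1, 0).
have [d d0 dE] := iter_gstep_mod8 true q (iter (p %% 8) (gstep false) (1, 0)).
exists (c * d); first exact: mulr_gt0.
by rewrite iter_gstep_scale dE /gscale /= !mulrA.
Qed.

Definition gval (t : bool) z : int := if t then z.1 - z.2 else z.1 + z.2.

(** The argument of [z] is [d] times pi/4; the entries are the signs of its real part and of its
    real part plus or minus its imaginary part. [gtableP] checks the 64 pairs of residues by
    computation. *)
Definition gtable (p q : nat) : bool :=
  let z := iter q (gstep true) (iter p (gstep false) (1, 0)) in
  let d := ((p + 7 * q) %% 8)%N in
  [&& all (fun t =>
        [&& (d \in if t then [:: 2; 3; 4] else [:: 4; 5; 6])%N ==> (gval t z < 0),
            (d \in if t then [:: 6; 7; 0] else [:: 0; 1; 2])%N ==> (0 < gval t z) &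
            (d \in if t then [:: 1; 5] else [:: 3; 7])%N ==> (gval t z == 0)]) [:: false; true],
      (d \in [:: 3; 4; 5])%N ==> (z.1 < 0),
      (d \in [:: 7; 0; 1])%N ==> (0 < z.1) &
      (d \in [:: 2; 6])%N ==> (z.1 == 0)].

Lemma gtableP p q : (p < 8)%N -> (q < 8)%N -> gtable p q.
Proof.
have : all (fun p => all (gtable p) (iota 0 8)) (iota 0 8) by vm_compute.
move=> /allP h p8 q8; have /h /allP h' : p \in iota 0 8 by rewrite mem_iota.
by apply: h'; rewrite mem_iota.
Qed.

Lemma gauss_signs n p t : (p <= n)%N ->
  let d := ((p + 7 * (n - p)) %% 8)%N in
  [/\ d \in (if t then [:: 2; 3; 4] else [:: 4; 5; 6])%N ->
        gam [set: {set 'I_n}] (qf (bcl n p t)) < 0,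
      d \in (if t then [:: 6; 7; 0] else [:: 0; 1; 2])%N ->
        0 < gam [set: {set 'I_n}] (qf (bcl n p t)) &
      d \in (if t then [:: 1; 5] else [:: 3; 7])%N ->
        gam [set: {set 'I_n}] (qf (bcl n p t)) = 0] /\
  [/\ d \in [:: 3; 4; 5]%N -> gam (evn n) (qf (bcl n p t)) < 0,
      d \in [:: 7; 0; 1]%N -> 0 < gam (evn n) (qf (bcl n p t)) &
      d \in [:: 2; 6]%N -> gam (evn n) (qf (bcl n p t)) = 0].
Proof.
move=> pn d.
have -> : gam (evn n) (qf (bcl n p t)) = psum n p false n.
  rewrite -gam_evn; apply: eq_bigr => A; rewrite inE => /negbTE oA.
  by rewrite qf_bcl oA andbF addbF.
rewrite gam_setT; have [c c0] := gpow_mod8 p (n - p); rewrite subnKC // -(psum_gpow _ (leqnn n)).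
have -> : d = ((p %% 8 + 7 * ((n - p) %% 8)) %% 8)%N by rewrite /d; lia.
move: (ltn_pmod p (isT : 0 < 8)%N) (ltn_pmod (n - p) (isT : 0 < 8)%N).
move=> p8 q8; move: (gtableP p8 q8); rewrite /gtable.
set z := iter _ _ _; set e := (_ %% 8)%N => /and4P[/= /and3P[h0 h1 _] h2 h3 h4] [-> ->].
have {h0 h1} /and3P[h5 h6 h7] : [&& (e \in if t then [:: 2; 3; 4] else [:: 4; 5; 6])%N ==> (gval t z < 0),
    (e \in if t then [:: 6; 7; 0] else [:: 0; 1; 2])%N ==> (0 < gval t z) &
    (e \in if t then [:: 1; 5] else [:: 3; 7])%N ==> (gval t z == 0)] by case: t.
have -> : c * z.1 + (-1) ^+ t * (c * z.2) = c * gval t z.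
  by rewrite /gval; case: t {h5 h6 h7}; rewrite ?expr0 ?expr1; ring.
split; split=> de.
- by rewrite pmulr_rlt0 //; exact: (implyP h5).
- by rewrite pmulr_rgt0 //; exact: (implyP h6).
- by rewrite (eqP (implyP h7 de)) mulr0.
- by rewrite pmulr_rlt0 //; exact: (implyP h2).
- by rewrite pmulr_rgt0 //; exact: (implyP h3).
- by rewrite (eqP (implyP h4 de)) mulr0.
Qed.

End GaussSigns.

(** * Radicals of the Clifford polar form *)

Section CliffordForms.
Local Open Scope ring_scope.
Variables (n p : nat) (t : bool).
Local Notation I := 'I_n.
Local Notation V := {set I}.
Local Notation "A :+: B" := (symd A B) (at level 50, left associativity).
Local Notation b := (bcl n p t).
Implicit Types (A B u v w : V).

Lemma card_subsets : #|[set: V]| = (2 ^ n)%N.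
Proof. by rewrite -powersetT card_powerset cardsT card_ord. Qed.

Lemma card_evn : (0 < n)%N -> (2 * #|evn n| = 2 ^ n)%N.
Proof.
move=> n0; rewrite -card_subsets.
rewrite (@card_hyperplane n [set: V] [set (Ordinal n0 : I)] (fun A => odd #|A|)) ?inE ?cards1 //.
- by congr (2 * _)%N; apply: eq_card => A; rewrite !inE.
- exact: subsp_setT.
- exact: odd_symd.
Qed.

Lemma pol_setT w : pol b w setT = odd #|w| && ~~ odd n.
Proof. by rewrite pol_bcl cardsT card_ord setIT; case: (odd #|w|); case: (odd n). Qed.

(** Pairing with singletons detects membership up to a constant, so one generator inside [w] and one
    outside give an even witness. *)
Lemma radical_bcl w : w != set0 -> w != setT -> exists2 u, u \in evn n & pol b w u.
Proof.
move=> /set0Pn[a aw]; rewrite -subTset => /subsetPn[c _ cw].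
exists ([set a] :+: [set c]); first by rewrite inE odd_symd !cards1.
by rewrite polDr !pol_bcl1 aw (negbTE cw); case: (odd _).
Qed.

Lemma nondeg_setT : ~~ odd n -> nondeg b [set: V].
Proof.
move=> on w _ w0; have [->|wT] := eqVneq w setT.
  have n0 : (0 < n)%N.
    by case/set0Pn: w0 => a _; exact: leq_ltn_trans (ltn_ord a).
  exists [set (Ordinal n0 : I)]; first by rewrite inE.
  by rewrite pol_bcl1 cardsT card_ord (negbTE on) inE.
by have [u _ wu] := radical_bcl w0 wT; exists u; rewrite ?inE.
Qed.

Lemma nondeg_evn : odd n -> nondeg b (evn n).
Proof.
move=> on w we w0; apply: radical_bcl => //.
by apply: contraTneq we => ->; rewrite inE cardsT card_ord on.
Qed.

Lemma qf_bcl_quadratic p' t' u v :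
  qf (bcl n p' t') (u :+: v) = qf (bcl n p' t') u (+) qf (bcl n p' t') v (+) pol b u v.
Proof. by rewrite qfD !pol_bcl. Qed.

End CliffordForms.

(** * The group types for Clifford forms, where [n - ev] is the dimension of [V0] *)

Section CliffordGroups.
Local Open Scope ring_scope.
Variables (R : realType) (n p : nat) (t h ev : bool).
Local Notation V := {set 'I_n}.
Local Notation b := (bcl n p t).
Local Notation s := (qf (bcl n n h)).
Local Notation V0 := (if ev then evn n else [set: V]).
Hypotheses (n0 : (0 < n)%N) (gamV0 : gam V0 (qf b) < 0).

Let hV0 : subsp V0. Proof. by case: ev; [exact: subsp_evn|exact: subsp_setT]. Qed.
Let sD := @qf_bcl_quadratic n p t n h.

Let nd : ~~ odd (n - ev) -> nondeg b V0.
Proof.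
case: ev => /=; last by rewrite subn0; exact: nondeg_setT.
by rewrite oddB // addbT negbK; exact: nondeg_evn.
Qed.

Let cardV0 : #|V0| = (2 ^ (n - ev))%N.
Proof.
case: ev => /=; last by rewrite subn0 card_subsets.
apply/eqP; rewrite -(eqn_pmul2l (isT : 0 < 2)%N) card_evn //.
by rewrite -expnS subn1 prednK.
Qed.

Let card2 k : (n - ev = 2 * k)%N -> #|V0| = (4 ^ k)%N.
Proof. by rewrite cardV0 => ->; rewrite expnM. Qed.
Let card2S k : (n - ev = (2 * k).+1)%N -> #|V0| = (2 * 4 ^ k)%N.
Proof. by rewrite cardV0 => ->; rewrite expnS expnM. Qed.

Lemma cliff_Sp k : (n - ev = 2 * k.+1)%N -> (forall w, w \in V0 -> s w = qf b w) ->
  lie_iso (TG R b V0 s) (SpH R (2 ^ k)).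
Proof.
by move=> e; apply: TG_Sp => //; [apply: nd; rewrite e oddM|exact: card2].
Qed.

Lemma cliff_OH k : (n - ev = 2 * k.+1)%N -> 0 < gam V0 s ->
  lie_iso (TG R b V0 s) (OH R (2 ^ k)).
Proof.
by move=> e; apply: TG_OH => //; [apply: nd; rewrite e oddM|exact: card2].
Qed.

Lemma cliff_SpRS k : (n - ev = 2 * k.+2)%N -> gam V0 s < 0 ->
  (exists2 w, w \in V0 & s w != qf b w) ->
  lie_iso (TG R b V0 s) (SpRS R (2 ^ k) (2 ^ k)).
Proof.
by move=> e; apply: TG_SpRS => //; [apply: nd; rewrite e oddM|exact: card2].
Qed.

Let omV k : (n - ev = (2 * k).+1)%N -> setT \in V0.
Proof.
case: ev => [e|_]; last by rewrite inE.
rewrite inE cardsT card_ord; have <- : odd (n - true).+1 = odd n by rewrite subn1 prednK.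
by rewrite e /= negbK oddM.
Qed.
Let om_central k : (n - ev = (2 * k).+1)%N -> forall v, v \in V0 -> pol b v setT = false.
Proof.
move=> e v; rewrite pol_setT; move: e; case: ev => [_|]; first by rewrite inE => /negbTE ->.
rewrite subn0 => e _; have -> : odd n by rewrite e /= oddM.
by rewrite andbF.
Qed.
Let rad w : w \in V0 -> w != set0 -> w != setT -> exists2 u, u \in V0 & pol b w u.
Proof.
move=> _ w0 wT; have [u ue wu] := radical_bcl p t w0 wT.
by exists u => //; case: ev; rewrite ?ue ?inE.
Qed.
(** A linear form nonzero on the full set, so that its kernel complements the radical. *)
Let l (A : V) := Ordinal n0 \in A.
Let lT : l setT. Proof. by rewrite /l inE. Qed.
Let lD u v : l (symd u v) = l u (+) l v. Proof. exact: in_symd. Qed.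

Lemma cliff_dSp k : (n - ev = (2 * k.+1).+1)%N -> (forall w, w \in V0 -> s w = qf b w) ->
  lie_iso (TG R b V0 s) (dupG (SpH R (2 ^ k))).
Proof.
by move=> e; exact: (TG_dup_Sp R hV0 (omV e) lT lD (om_central e) rad gamV0 sD (card2S e)).
Qed.

Lemma cliff_dOH k : (n - ev = (2 * k.+1).+1)%N -> 0 < gam V0 s ->
  lie_iso (TG R b V0 s) (dupG (OH R (2 ^ k))).
Proof.
by move=> e; exact: (TG_dup_OH R hV0 (omV e) lT lD (om_central e) rad gamV0 sD (card2S e)).
Qed.

Lemma cliff_dSpRS k : (n - ev = (2 * k.+2).+1)%N -> gam V0 s < 0 ->
  (exists2 w, w \in V0 & s w != qf b w) ->
  lie_iso (TG R b V0 s) (dupG (SpRS R (2 ^ k) (2 ^ k))).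
Proof.
by move=> e; exact: (TG_dup_SpRS R hV0 (omV e) lT lD (om_central e) rad gamV0 sD (card2S e)).
Qed.

Lemma cliff_GL k : (n - ev = (2 * k.+1).+1)%N -> gam V0 s = 0 ->
  lie_iso (TG R b V0 s) (GLH R (2 ^ k)).
Proof.
by move=> e; exact: (TG_radical_GL R hV0 (omV e) lT lD (om_central e) rad gamV0 sD (card2S e)).
Qed.

End CliffordGroups.

(** * Product and reversion in the standard basis *)

Section CliffordBasis.
Local Open Scope ring_scope.
Variables (R : realType) (n p : nat).
Local Notation I := 'I_n.
Local Notation V := {set I}.
Local Notation "A :+: B" := (symd A B) (at level 50, left associativity).
Local Notation b := (bcl n p false).
Local Notation rho := (qf (bcl n n false)).
Implicit Types (A B C : V).

Lemma prod_eta (D : V) : \prod_(a in D) @Defs.eta R p n a = (-1) ^+ #|[set a in D | (p <= a)%N]|.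
Proof.
rewrite (bigID (fun a : I => (p <= a)%N)) /= [X in _ * X]big1 ?mulr1 => [|a /andP[_]]; last first.
  by rewrite -ltnNge /Defs.eta => ->.
rewrite -big_filter -prodr_const.
under [RHS]eq_bigl => a do rewrite inE.
rewrite big_filter; apply: eq_bigr => a /andP[_ pa].
by rewrite /Defs.eta ltnNge pa.
Qed.

Lemma bsignE A B : bsign (R := R) p A B = (-1) ^+ b A B.
Proof.
have -> : b A B = bform (fun a c => (c < a)%N) A B (+)
    bform (fun a c => (a == c) && (p <= a)%N) A B.
  rewrite -bform_addb; apply: eq_bform => a c; rewrite /clr addbF -(inj_eq val_inj) /=.
  by case: ltngtP.
rewrite signr_addb /bform !signr_odd /bsign prod_eta; congr (_ * (_ ^+ _)).
rewrite -(card_imset _ (f := fun a : I => (a, a))); last by move=> a c [].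
apply: eq_card => -[a c]; rewrite [RHS]inE /=.
apply/imsetP/and4P => [[x + [-> ->]]|[aA cB /eqP ac pa]].
  by rewrite !inE => /andP[/andP[-> ->] ->].
by exists a; rewrite ?inE ?aA ?pa ac ?cB.
Qed.

Lemma clmulE (x y : cl R n) C :
  clmul p x y C = \sum_A (-1) ^+ b A (A :+: C) * x A * y (A :+: C).
Proof.
apply: eq_bigr => A _; rewrite (big_pred1 (A :+: C)) ?bsignE // => B.
by rewrite /= symd_eq.
Qed.

(** Reordering distinct generators never squares one of them, so the sign is that of the form in
    which all generators square to [e]. *)
Lemma foldr_gen (s : seq I) : sorted (fun a c : I => (c < a)%N) s -> forall C,
  foldr (@clmul R p n) (clone R n) (map (@gen R n) s) C =
  (-1) ^+ rho [set a in s] * (C == [set a in s])%:R.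
Proof.
elim: s => [_ C|a s IHs hs C] /=.
  by rewrite set_nil [qf _ _](qf0 (bcl n n false)) expr0 mul1r.
have sa : {in s, forall c : I, (c < a)%N}.
  move: hs; rewrite /= (path_sortedE (leT := fun a c : I => (c < a)%N)) => [/andP[/allP //]|].
  by move=> x y z xy yz; exact: ltn_trans yz xy.
have ans : a \notin s by apply/negP => /sa; rewrite ltnn.
have setE : [set c in a :: s] = [set a] :+: [set c in s].
  apply/setP => c; rewrite in_symd !inE.
  by case: eqP => [->|]; rewrite ?(negbTE ans).
rewrite clmulE (bigD1 [set a]) //= big1 => [|A /negbTE Aa]; last first.
  by rewrite /gen Aa mulr0 mul0r.
rewrite addr0 /gen eqxx mulr1 IHs; last exact: path_sorted hs.
rewrite setE [_ == [set c in s]](_ : _ = (C == [set a] :+: [set c in s])); last first.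
  by rewrite symd_eq.
case: eqP => [->|]; last by rewrite !mulr0.
rewrite !mulr1 symdK -signr_addb; congr (_ ^+ nat_of_bool _).
rewrite qfD polC pol_bcl1 qf_bcl1 leqNgt ltn_ord inE (negbTE ans) addbF /= addbC.
congr (_ (+) _); rewrite -[odd _]/(true && odd #|[set c in s]|) -[true]/(odd 1) -(cards1 a) -bform_true.
rewrite !bformE; apply: eq_bigr => x _; rewrite /clr !inE addbF.
by case: eqP => [->|] //=; case: (boolP (x.2 \in s)) => //= /sa ->.
Qed.

Lemma clrevE (x : cl R n) C : clrev p x C = (-1) ^+ rho C * x C.
Proof.
have hs A : foldr (@clmul R p n) (clone R n) (map (@gen R n) (rev (enum A))) C =
    (-1) ^+ rho A * (C == A)%:R.
  have eA : [set a in rev (enum A)] = A by apply/setP => a; rewrite inE mem_rev mem_enum.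
  rewrite foldr_gen ?eA // rev_sorted.
  rewrite /enum_mem; apply: sorted_filter; first by move=> a c d ca dc; exact: ltn_trans ca dc.
  by rewrite -enumT -(sorted_map (f := val) (e' := ltn)) val_enum_ord iota_ltn_sorted.
rewrite /clrev (bigD1 C) //= big1 => [|A /negbTE AC].
  by rewrite hs eqxx mulr1 addr0 mulrC.
by rewrite hs eq_sym AC !mulr0.
Qed.

End CliffordBasis.

(** * The five families as twisted groups *)

Section Families.
Local Open Scope ring_scope.
Local Notation coord := Defs.coord.
Variables (R : realType) (p q : nat).
Local Notation n := (p + q)%N.
Local Notation V := {set 'I_n}.
Local Notation "A :+: B" := (symd A B) (at level 50, left associativity).
Local Notation rho h := (qf (bcl n n h)).

Section RealFamilies.
Local Notation b := (bcl n p false).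

Definition cltw (x : cl R n) : tw R b := [ffun A => x A].

Lemma cltwM x y : cltw (clmul p x y) = cltw x * cltw y.
Proof.
apply/ffunP => C; rewrite tw_mulE ffunE clmulE.
by apply: eq_bigr => A _; rewrite !ffunE.
Qed.

Lemma cltw_eq x y : cltw x = cltw y <-> x = y.
Proof.
by split=> [/ffunP e|-> //]; apply/funext => A; have := e A; rewrite !ffunE.
Qed.

Lemma cltw1 : cltw (clone R n) = 1. Proof. by apply/ffunP => A; rewrite !ffunE. Qed.

Lemma cltw_rev x : cltw (clrev p x) = sig (rho false) (cltw x).
Proof. by apply/ffunP => A; rewrite sigE !ffunE clrevE. Qed.

Lemma cltw_rev_hat x : cltw (clrev p (clhat x)) = sig (rho true) (cltw x).
Proof.
apply/ffunP => A; rewrite sigE !ffunE clrevE /clhat (qf_bcl _ true) /= mulrA -[X in _ * X * _]signr_odd.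
by rewrite -signr_addb.
Qed.

Lemma real_family (P : cl R n -> Prop) V0 s :
  (forall x, P x <-> sup V0 (cltw x) /\ sig s (cltw x) * cltw x = 1) ->
  lie_iso (mkCl R p q P) (TG R b V0 s).
Proof.
move=> hP; exists cltw, (fun (y : tw R b) A => y A); split => /=.
- by move=> x Px; apply/hP.
- move=> y hy; apply/hP; rewrite (_ : cltw _ = y) //.
  by apply/ffunP => A; rewrite ffunE.
- by move=> x _; apply/funext => A; rewrite ffunE.
- by move=> y _; apply/ffunP => A; rewrite ffunE.
split.
- by move=> x y _ _; exact: cltwM.
- move=> x _ eps eps0; exists eps => // y _ hxy A.
  by rewrite /= !ffunE; exact: hxy.
- by move=> x _ eps eps0; exists eps.
Qed.

Lemma sup_setT (x : tw R b) : sup [set: V] x.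
Proof. by move=> v; rewrite inE. Qed.

Lemma sup_evnP x : sup (evn n) (cltw x) <-> cleven x.
Proof.
split=> h A hA; first by have := h A; rewrite inE negbK ffunE; exact.
by rewrite ffunE; apply: h; rewrite inE negbK in hA.
Qed.

Lemma G23_TG : lie_iso (G23 R p q) (TG R b [set: V] (rho false)).
Proof.
apply: real_family => x; rewrite -cltw_rev -cltwM -cltw1 cltw_eq.
by split=> [e|[]] //; split=> //; exact: sup_setT.
Qed.

Lemma G12_TG : lie_iso (G12 R p q) (TG R b [set: V] (rho true)).
Proof.
apply: real_family => x; rewrite -cltw_rev_hat -cltwM -cltw1 cltw_eq.
by split=> [e|[]] //; split=> //; exact: sup_setT.
Qed.

Lemma G2_TG : lie_iso (G2 R p q) (TG R b (evn n) (rho false)).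
Proof.
by apply: real_family => x; rewrite -cltw_rev -cltwM -cltw1 cltw_eq sup_evnP.
Qed.

End RealFamilies.

Section ComplexFamilies.
Local Notation b := (bcl n p true).

Definition graded (U : ccl R n) := cleven U.1 /\ clodd U.2.

(** Coordinates in the basis [e_A] for even and [i e_A] for odd [A]; the extra sign in a product of
    two odd elements is the flag [t = true] of the cocycle. *)
Definition ccltw (U : ccl R n) : tw R b := [ffun A : V => if odd #|A| then U.2 A else U.1 A].
Definition twccl (y : tw R b) : ccl R n :=
  (fun A : V => if odd #|A| then 0 else y A, fun A : V => if odd #|A| then y A else 0).

Lemma ccltwK U : graded U -> twccl (ccltw U) = U.
Proof.
case: U => x y [/= hx hy]; congr (_, _); apply/funext => A; rewrite ffunE /=.
  by case: (boolP (odd #|A|)) => oA //; rewrite hx.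
by case: (boolP (odd #|A|)) => oA //; rewrite hy.
Qed.

Lemma twcclK y : ccltw (twccl y) = y.
Proof. by apply/ffunP => A; rewrite ffunE /=; case: (odd _). Qed.

Lemma graded_twccl y : graded (twccl y).
Proof. by split=> A /=; [move=> ->|move=> /negbTE ->]. Qed.

Let b'E (A B : V) : bform (clr p true) A B = bform (clr p false) A B (+) (odd #|A| && odd #|B|).
Proof.
by rewrite -bform_true -bform_addb; apply: eq_bform => a c; rewrite /clr addbF.
Qed.

Lemma ccltwM U U' : graded U -> graded U' -> ccltw (cmul p U U') = ccltw U * ccltw U'.
Proof.
move=> [e1 o2] [e1' o2']; apply/ffunP => C; rewrite tw_mulE ffunE /= /cladd /clopp !clmulE.
case: ifP => oC; [rewrite -big_split|rewrite -sumrB]; apply: eq_bigr => A _ /=;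
  rewrite !ffunE b'E odd_symd oC; case: (boolP (odd #|A|)) => oA /=;
  rewrite ?addbF ?addbT.
- by rewrite (e1 A oA) mulr0 mul0r add0r.
- by rewrite (o2 A oA) mulr0 mul0r addr0.
- rewrite (e1 A oA) mulr0 mul0r sub0r.
  by case: (bform _ A _); rewrite ?expr0 ?expr1 ?mulN1r ?mul1r ?mulNr ?opprK.
- by rewrite (o2 A oA) mulr0 mul0r subr0.
Qed.

Lemma graded_cmul U U' : graded U -> graded U' -> graded (cmul p U U').
Proof.
move=> [e1 o2] [e1' o2']; split=> C hC; rewrite /= /cladd /clopp !clmulE.
  rewrite -sumrB big1 // => A _; case: (boolP (odd #|A|)) => oA.
    by rewrite (e1 A oA) (o2' (A :+: C)) ?mulr0 ?mul0r ?subr0 // odd_symd oA hC.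
  by rewrite (o2 A oA) (e1' (A :+: C)) ?mulr0 ?mul0r ?subr0 // odd_symd (negbTE oA) hC.
rewrite -big_split big1 // => A _; case: (boolP (odd #|A|)) => oA /=.
  by rewrite (e1 A oA) (e1' (A :+: C)) ?mulr0 ?mul0r ?addr0 // odd_symd oA (negbTE hC).
by rewrite (o2 A oA) (o2' (A :+: C)) ?mulr0 ?mul0r ?addr0 // odd_symd (negbTE oA) (negbTE hC).
Qed.

Lemma ccltw1 : ccltw (cone R n) = 1.
Proof.
apply/ffunP => A; rewrite !ffunE /= /clone /clzero; case: ifP => // oA.
by case: eqP oA => // ->; rewrite cards0.
Qed.

Lemma graded_one : graded (cone R n).
Proof.
split=> A hA //=; rewrite /clone; case: eqP => // A0.
by move: hA; rewrite A0 cards0.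
Qed.

Lemma ccltw_eq1 U U' : graded U -> graded U' ->
  cmul p U U' = cone R n <-> ccltw U * ccltw U' = 1.
Proof.
move=> gU gU'; rewrite -ccltwM //; split=> [->|e]; first exact: ccltw1.
by rewrite -(ccltwK (graded_cmul gU gU')) e -ccltw1 (ccltwK graded_one).
Qed.

Lemma graded_dag U : graded U -> graded (cdag p U).
Proof.
move=> [e o]; split=> A hA; rewrite /= clrevE ?e ?mulr0 //.
by rewrite /clopp o // oppr0 mulr0.
Qed.

Lemma graded_hat U : graded U -> graded (chat U).
Proof. by move=> [e o]; split=> A hA; rewrite /= /clhat ?e ?o ?mulr0. Qed.

(** Complex conjugation negates the odd coordinates, so it acts like the grade involution. *)
Lemma ccltw_dag U : ccltw (cdag p U) = sig (rho true) (ccltw U).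
Proof.
apply/ffunP => A; rewrite sigE !ffunE /= !clrevE (qf_bcl _ true) /= /clopp.
by case: (odd _); rewrite ?addbF // addbT; case: (rho false A); rewrite ?expr0 ?expr1; ring.
Qed.

Lemma ccltw_dag_hat U : ccltw (cdag p (chat U)) = sig (rho false) (ccltw U).
Proof.
apply/ffunP => A; rewrite sigE !ffunE /= !clrevE /clopp /clhat -[_ ^+ #|_|]signr_odd.
by case: (odd _); rewrite /= ?expr0 ?expr1; ring.
Qed.

Lemma complex_family (P : ccl R n -> Prop) s :
  (forall U, P U <-> graded U /\ sig s (ccltw U) * ccltw U = 1) ->
  lie_iso (mkCCl R p q P) (TG R b [set: V] s).
Proof.
move=> hP; exists ccltw, twccl; split => /=.
- by move=> U /hP[_ e]; split=> // v; rewrite inE.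
- by move=> y [_ e]; apply/hP; rewrite twcclK; split=> //; exact: graded_twccl.
- by move=> U /hP[g _]; exact: ccltwK.
- by move=> y _; exact: twcclK.
split.
- by move=> U U' /hP[g _] /hP[g' _]; exact: ccltwM.
- move=> U _ eps eps0; exists eps => // U' _ hU A; rewrite /= !ffunE.
  by case: ifP => _; [exact: (hU (inr A))|exact: (hU (inl A))].
- move=> y _ eps eps0; exists eps => // y' _ hy [] A /=; case: (odd _);
    by rewrite ?subrr ?normr0 //; exact: hy.
Qed.

Lemma G2i1_TG : lie_iso (G2i1 R p q) (TG R b [set: V] (rho true)).
Proof.
apply: complex_family => U; rewrite -ccltw_dag; split=> [[e o h]|[[e o] h]].
  by split; [split|apply/ccltw_eq1; [exact: graded_dag|split|]].
by split=> //; apply/ccltw_eq1; [exact: graded_dag|split|].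
Qed.

Lemma G2i3_TG : lie_iso (G2i3 R p q) (TG R b [set: V] (rho false)).
Proof.
apply: complex_family => U; rewrite -ccltw_dag_hat; split=> [[e o h]|[[e o] h]].
  by split; [split|apply/ccltw_eq1; [exact/graded_dag/graded_hat|split|]].
by split=> //; apply/ccltw_eq1; [exact/graded_dag/graded_hat|split|].
Qed.

End ComplexFamilies.

End Families.

(** * Case analysis on [p], [q] and [n] *)

Section Classification.
Variables (R : realType) (p q : nat).
Local Notation n := (p + q).
Local Notation V := {set 'I_n}.

Lemma qf_bcl_definite t (A : V) : q = 0 -> qf (bcl n p t) A = qf (bcl n n t) A.
Proof.
move=> q0; apply: eq_bform => a c; rewrite /clr; congr ((_ || _ && _) (+) _).
by apply: (congr1 (fun m => m <= a)); rewrite q0 addn0.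
Qed.

(** Negating the squares of all generators adds the parity of [#|A|], just as toggling [t] does. *)
Lemma qf_bcl_negative t (A : V) : p = 0 -> qf (bcl n p t) A = qf (bcl n n (~~ t)) A.
Proof.
move=> p0; rewrite qf_bcl [RHS]qf_bcl.
have -> : qf (bcl n p false) A = qf (bcl n n false) A (+) odd #|A|.
  rewrite /qf /= -[in odd _](setIid A) -bform_eq -bform_addb; apply: eq_bform => a c.
  have pa : p <= a by apply: leq_trans (leq0n a); rewrite leqn0; apply/eqP.
  by rewrite /clr !addbF pa [n <= a]leqNgt ltn_ord andbF orbF andbT -(inj_eq val_inj) /=;
     case: ltngtP.
by case: t; rewrite /= ?addbF // -addbA addbb addbF.
Qed.

Lemma qf_bcl_set1 p' t (a : 'I_n) : qf (bcl n p' t) [set a] = (p' <= a) (+) t.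
Proof. by rewrite qf_bcl qf_bcl1 cards1 andbT. Qed.

Lemma bcl_last : q != 0 -> exists2 a : 'I_n, p <= a & n <= a = false.
Proof.
move=> q0; have an : n.-1 < n by lia.
by exists (Ordinal an) => /=; lia.
Qed.

Lemma bcl_first : p != 0 -> exists2 a : 'I_n, p <= a = false & n <= a = false.
Proof.
move=> p0; have an : 0 < n by lia.
by exists (Ordinal an) => /=; lia.
Qed.

Let mod_s : (n + 7 * (n - n)) %% 8 = n %% 8.
Proof. by rewrite subnn muln0 addn0. Qed.
Let mod_q : (p + 7 * (n - p)) %% 8 = pqmod8 p q.
Proof. by rewrite addKn. Qed.

Hypothesis n0 : 0 < n.

(** Families (i) to (iv) are the four choices of the algebra flag [t] and the involution flag [h].
    The number [z] counts the generators on which the two signs disagree, so the signs coincide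
    exactly when [z = 0]. *)
Lemma classify_full t h (G : mgrp R) :
  lie_iso G (TG R (bcl n p t) [set: V] (qf (bcl n n h))) ->
  pqmod8 p q \in (if t then [:: 2; 3; 4] else [:: 4; 5; 6]) ->
  let z := if t == h then q else p in
  ((z == 0) && ~~ odd n -> lie_iso G (SpH R (2 ^ ((n - 2) %/ 2)))) /\
  ((n %% 8 \in (if h then [:: 2; 4] else [:: 4; 6])) && (z != 0) ->
    lie_iso G (SpRS R (2 ^ ((n - 4) %/ 2)) (2 ^ ((n - 4) %/ 2)))) /\
  (n %% 8 \in (if h then [:: 0; 6] else [:: 0; 2]) ->
    lie_iso G (OH R (2 ^ ((n - 2) %/ 2)))) /\
  ((z == 0) && odd n -> lie_iso G (dupG (SpH R (2 ^ ((n - 3) %/ 2))))) /\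
  ((n %% 8 == (if h then 3 else 5)) && (z != 0) ->
    lie_iso G (dupG (SpRS R (2 ^ ((n - 5) %/ 2)) (2 ^ ((n - 5) %/ 2))))) /\
  (n %% 8 == (if h then 7 else 1) -> lie_iso G (dupG (OH R (2 ^ ((n - 3) %/ 2))))) /\
  (n %% 8 \in (if h then [:: 1; 5] else [:: 3; 7]) ->
    lie_iso G (GLH R (2 ^ ((n - 3) %/ 2)))).
Proof.
move=> GTG dt z.
have [[gQ _ _] _] := @gauss_signs n p t (leq_addr q p).
have [[gneg gpos gzero] _] := @gauss_signs n n h (leqnn n).
rewrite mod_q in gQ; rewrite mod_s in gneg gpos gzero.
have {}gQ := gQ dt.
have trivial_sign : z = 0 -> forall w : V, w \in [set: V] ->
    qf (bcl n n h) w = qf (bcl n p t) w.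
  rewrite /z; case: (t =P h) => [-> q0|/eqP th p0] w _; first by rewrite qf_bcl_definite.
  by rewrite qf_bcl_negative //; congr (qf (bcl n n _) w); move: th; move: (t) (h) => [] [].
have nontrivial_sign : z != 0 -> exists2 w : V, w \in [set: V] &
    qf (bcl n n h) w != qf (bcl n p t) w.
  rewrite /z; case: (t =P h) => [-> q0|/eqP th p0].
    have [a pa na] := bcl_last q0; exists [set a]; rewrite ?inE //.
    by rewrite !qf_bcl_set1 pa na; move: (h) => [].
  have [a pa na] := bcl_first p0; exists [set a]; rewrite ?inE //.
  by rewrite !qf_bcl_set1 pa na; move: th; move: (t) (h) => [] [].
have tw k G' : (n - false = k -> lie_iso (TG R (bcl n p t) [set: V] (qf (bcl n n h))) G') ->
    n = k -> lie_iso G G'.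
  by move=> hG nk; apply: lie_iso_trans GTG (hG _); rewrite subn0.
rewrite /pqmod8 in dt.
split=> [/andP[/eqP z0 on]|].
  apply: (tw (2 * ((n - 2) %/ 2).+1)); last by lia.
  by move=> e; apply: (@cliff_Sp R n p t h false n0 gQ _ e (trivial_sign z0)).
split=> [/andP[nm z0]|].
  apply: (tw (2 * ((n - 4) %/ 2).+2)).
    move=> e; apply: (@cliff_SpRS R n p t h false n0 gQ _ e _ (nontrivial_sign z0)).
    by apply: gneg; move: nm; move: (h) => []; rewrite !inE => /orP[] ->; rewrite ?orbT.
  (* The exponent needs [n >= 4]; the case [n = 2] is excluded by the residue of [p - q] together
     with [z != 0]. *)
  by move: dt nm z0; rewrite /z; case: (t); case: (h); rewrite !inE /=; lia.
split=> [nm|].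
  apply: (tw (2 * ((n - 2) %/ 2).+1)).
    move=> e; apply: (@cliff_OH R n p t h false n0 gQ _ e).
    by apply: gpos; move: nm; move: (h) => []; rewrite !inE => /orP[] ->; rewrite ?orbT.
  by move: nm; case: (h); rewrite !inE; lia.
split=> [/andP[/eqP z0 on]|].
  apply: (tw (2 * ((n - 3) %/ 2).+1).+1).
    by move=> e; apply: (@cliff_dSp R n p t h false n0 gQ _ e (trivial_sign z0)).
  by move: dt; case: (t); rewrite !inE; lia.
split=> [/andP[nm z0]|].
  apply: (tw (2 * ((n - 5) %/ 2).+2).+1).
    move=> e; apply: (@cliff_dSpRS R n p t h false n0 gQ _ e _ (nontrivial_sign z0)).
    by apply: gneg; move: nm; move: (h) => [] /eqP ->.
  by move: dt nm z0; rewrite /z; case: (t); case: (h); rewrite !inE /=; lia.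
split=> [nm|nm].
  apply: (tw (2 * ((n - 3) %/ 2).+1).+1).
    move=> e; apply: (@cliff_dOH R n p t h false n0 gQ _ e).
    by apply: gpos; move: nm; move: (h) => [] /eqP ->.
  by move: dt nm; case: (t); case: (h); rewrite !inE; lia.
apply: (tw (2 * ((n - 3) %/ 2).+1).+1).
  by move=> e; apply: (@cliff_GL R n p t h false n0 gQ _ e); apply: gzero.
by move: dt nm; case: (t); case: (h); rewrite !inE; lia.
Qed.

(** On even subsets the parity term vanishes, so the two signs agree as soon as [p] or [q] is
    zero. *)
Lemma classify_even (G : mgrp R) :
  lie_iso G (TG R (bcl n p false) (evn n) (qf (bcl n n false))) ->
  pqmod8 p q \in [:: 3; 4; 5] ->
  (((p == 0) || (q == 0)) && odd n -> lie_iso G (SpH R (2 ^ ((n - 3) %/ 2)))) /\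
  ((n %% 8 \in [:: 3; 5]) && (p != 0) && (q != 0) ->
    lie_iso G (SpRS R (2 ^ ((n - 5) %/ 2)) (2 ^ ((n - 5) %/ 2)))) /\
  (n %% 8 \in [:: 1; 7] -> lie_iso G (OH R (2 ^ ((n - 3) %/ 2)))) /\
  (((p == 0) || (q == 0)) && ~~ odd n -> lie_iso G (dupG (SpH R (2 ^ ((n - 4) %/ 2))))) /\
  ((n %% 8 == 4) && (p != 0) && (q != 0) ->
    lie_iso G (dupG (SpRS R (2 ^ ((n - 6) %/ 2)) (2 ^ ((n - 6) %/ 2))))) /\
  (n %% 8 == 0 -> lie_iso G (dupG (OH R (2 ^ ((n - 4) %/ 2))))) /\
  (n %% 8 \in [:: 2; 6] -> lie_iso G (GLH R (2 ^ ((n - 4) %/ 2)))).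
Proof.
move=> GTG dt.
have [_ [gQ _ _]] := @gauss_signs n p false (leq_addr q p).
have [_ [gneg gpos gzero]] := @gauss_signs n n false (leqnn n).
rewrite mod_q in gQ; rewrite mod_s in gneg gpos gzero.
have {}gQ := gQ dt.
have trivial_sign : (p == 0) || (q == 0) -> forall w : V, w \in evn n ->
    qf (bcl n n false) w = qf (bcl n p false) w.
  move=> /orP[]/eqP z0 w we; last by rewrite qf_bcl_definite.
  rewrite qf_bcl_negative // [RHS]qf_bcl.
  by move: we; rewrite inE => /negbTE ->; rewrite addbF.
have nontrivial_sign : p != 0 -> q != 0 -> exists2 w : V, w \in evn n &
    qf (bcl n n false) w != qf (bcl n p false) w.
  move=> /bcl_first[a pa na] /bcl_last[c pc nc].
  (* An even set with one generator of each square: exactly one of the two changes the sign. *)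
  exists (symd [set a] [set c]); first by rewrite inE odd_symd !cards1.
  rewrite !qfD !qf_bcl_set1 pa na pc nc !pol_bcl.
  by move: (odd #|_ :&: _|) (odd #|_| && _) => [] [].
have tw k G' : (n - true = k -> lie_iso (TG R (bcl n p false) (evn n) (qf (bcl n n false))) G') ->
    n = k.+1 -> lie_iso G G'.
  by move=> hG nk; apply: lie_iso_trans GTG (hG _); rewrite nk subn1.
rewrite /pqmod8 !inE in dt.
split=> [/andP[/trivial_sign z0 on]|].
  apply: (tw (2 * ((n - 3) %/ 2).+1)); last by lia.
  by move=> e; apply: (@cliff_Sp R n p false false true n0 gQ _ e z0).
split=> [/andP[/andP[nm p0] q0]|].
  apply: (tw (2 * ((n - 5) %/ 2).+2)); last by move: nm; rewrite !inE; lia.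
  move=> e; apply: (@cliff_SpRS R n p false false true n0 gQ _ e _ (nontrivial_sign p0 q0)).
  by apply: gneg; move: nm; rewrite !inE => /orP[] ->; rewrite ?orbT.
split=> [nm|].
  apply: (tw (2 * ((n - 3) %/ 2).+1)); last by move: nm; rewrite !inE; lia.
  move=> e; apply: (@cliff_OH R n p false false true n0 gQ _ e).
  by apply: gpos; move: nm; rewrite !inE => /orP[] ->; rewrite ?orbT.
split=> [/andP[/trivial_sign z0 on]|].
  apply: (tw (2 * ((n - 4) %/ 2).+1).+1); last by lia.
  by move=> e; apply: (@cliff_dSp R n p false false true n0 gQ _ e z0).
split=> [/andP[/andP[nm p0] q0]|].
  apply: (tw (2 * ((n - 6) %/ 2).+2).+1); last by lia.
  move=> e; apply: (@cliff_dSpRS R n p false false true n0 gQ _ e _ (nontrivial_sign p0 q0)).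
  by apply: gneg; rewrite (eqP nm).
split=> [nm|nm].
  apply: (tw (2 * ((n - 4) %/ 2).+1).+1); last by lia.
  move=> e; apply: (@cliff_dOH R n p false false true n0 gQ _ e).
  by apply: gpos; rewrite (eqP nm).
apply: (tw (2 * ((n - 4) %/ 2).+1).+1); last by move: nm; rewrite !inE; lia.
by move=> e; apply: (@cliff_GL R n p false false true n0 gQ _ e); apply: gzero.
Qed.

End Classification.

Theorem theorem3 (R : realType) (p q : nat) :
  (1 <= p + q)%N ->
(* (i) *)
  (pqmod8 p q \in [:: 4; 5; 6] ->
    ((q == 0) && ~~ odd (p + q) ->
       lie_iso (G23 R p q) (SpH R (2 ^ ((p + q - 2) %/ 2)))) /\
    (((p + q) %% 8 \in [:: 4; 6]) && (q != 0) ->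
       lie_iso (G23 R p q) (SpRS R (2 ^ ((p + q - 4) %/ 2)) (2 ^ ((p + q - 4) %/ 2)))) /\
    ((p + q) %% 8 \in [:: 0; 2] ->
       lie_iso (G23 R p q) (OH R (2 ^ ((p + q - 2) %/ 2)))) /\
    ((q == 0) && odd (p + q) ->
       lie_iso (G23 R p q) (dupG (SpH R (2 ^ ((p + q - 3) %/ 2))))) /\
    (((p + q) %% 8 == 5) && (q != 0) ->
       lie_iso (G23 R p q) (dupG (SpRS R (2 ^ ((p + q - 5) %/ 2)) (2 ^ ((p + q - 5) %/ 2))))) /\
    ((p + q) %% 8 == 1 ->
       lie_iso (G23 R p q) (dupG (OH R (2 ^ ((p + q - 3) %/ 2))))) /\
    ((p + q) %% 8 \in [:: 3; 7] ->
       lie_iso (G23 R p q) (GLH R (2 ^ ((p + q - 3) %/ 2)))))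
  /\
(* (ii) *)
  (pqmod8 p q \in [:: 4; 5; 6] ->
    ((p == 0) && ~~ odd (p + q) ->
       lie_iso (G12 R p q) (SpH R (2 ^ ((p + q - 2) %/ 2)))) /\
    (((p + q) %% 8 \in [:: 2; 4]) && (p != 0) ->
       lie_iso (G12 R p q) (SpRS R (2 ^ ((p + q - 4) %/ 2)) (2 ^ ((p + q - 4) %/ 2)))) /\
    ((p + q) %% 8 \in [:: 0; 6] ->
       lie_iso (G12 R p q) (OH R (2 ^ ((p + q - 2) %/ 2)))) /\
    ((p == 0) && odd (p + q) ->
       lie_iso (G12 R p q) (dupG (SpH R (2 ^ ((p + q - 3) %/ 2))))) /\
    (((p + q) %% 8 == 3) && (p != 0) ->
       lie_iso (G12 R p q) (dupG (SpRS R (2 ^ ((p + q - 5) %/ 2)) (2 ^ ((p + q - 5) %/ 2))))) /\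
    ((p + q) %% 8 == 7 ->
       lie_iso (G12 R p q) (dupG (OH R (2 ^ ((p + q - 3) %/ 2))))) /\
    ((p + q) %% 8 \in [:: 1; 5] ->
       lie_iso (G12 R p q) (GLH R (2 ^ ((p + q - 3) %/ 2)))))
  /\
(* (iii) *)
  (pqmod8 p q \in [:: 2; 3; 4] ->
    ((q == 0) && ~~ odd (p + q) ->
       lie_iso (G2i1 R p q) (SpH R (2 ^ ((p + q - 2) %/ 2)))) /\
    (((p + q) %% 8 \in [:: 2; 4]) && (q != 0) ->
       lie_iso (G2i1 R p q) (SpRS R (2 ^ ((p + q - 4) %/ 2)) (2 ^ ((p + q - 4) %/ 2)))) /\
    ((p + q) %% 8 \in [:: 0; 6] ->
       lie_iso (G2i1 R p q) (OH R (2 ^ ((p + q - 2) %/ 2)))) /\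
    ((q == 0) && odd (p + q) ->
       lie_iso (G2i1 R p q) (dupG (SpH R (2 ^ ((p + q - 3) %/ 2))))) /\
    (((p + q) %% 8 == 3) && (q != 0) ->
       lie_iso (G2i1 R p q) (dupG (SpRS R (2 ^ ((p + q - 5) %/ 2)) (2 ^ ((p + q - 5) %/ 2))))) /\
    ((p + q) %% 8 == 7 ->
       lie_iso (G2i1 R p q) (dupG (OH R (2 ^ ((p + q - 3) %/ 2))))) /\
    ((p + q) %% 8 \in [:: 1; 5] ->
       lie_iso (G2i1 R p q) (GLH R (2 ^ ((p + q - 3) %/ 2)))))
  /\
(* (iv) *)
  (pqmod8 p q \in [:: 2; 3; 4] ->
    ((p == 0) && ~~ odd (p + q) ->
       lie_iso (G2i3 R p q) (SpH R (2 ^ ((p + q - 2) %/ 2)))) /\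
    (((p + q) %% 8 \in [:: 4; 6]) && (p != 0) ->
       lie_iso (G2i3 R p q) (SpRS R (2 ^ ((p + q - 4) %/ 2)) (2 ^ ((p + q - 4) %/ 2)))) /\
    ((p + q) %% 8 \in [:: 0; 2] ->
       lie_iso (G2i3 R p q) (OH R (2 ^ ((p + q - 2) %/ 2)))) /\
    ((p == 0) && odd (p + q) ->
       lie_iso (G2i3 R p q) (dupG (SpH R (2 ^ ((p + q - 3) %/ 2))))) /\
    (((p + q) %% 8 == 5) && (p != 0) ->
       lie_iso (G2i3 R p q) (dupG (SpRS R (2 ^ ((p + q - 5) %/ 2)) (2 ^ ((p + q - 5) %/ 2))))) /\
    ((p + q) %% 8 == 1 ->
       lie_iso (G2i3 R p q) (dupG (OH R (2 ^ ((p + q - 3) %/ 2))))) /\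
    ((p + q) %% 8 \in [:: 3; 7] ->
       lie_iso (G2i3 R p q) (GLH R (2 ^ ((p + q - 3) %/ 2)))))
  /\
(* (v) *)
  (pqmod8 p q \in [:: 3; 4; 5] ->
    (((p == 0) || (q == 0)) && odd (p + q) ->
       lie_iso (G2 R p q) (SpH R (2 ^ ((p + q - 3) %/ 2)))) /\
    (((p + q) %% 8 \in [:: 3; 5]) && (p != 0) && (q != 0) ->
       lie_iso (G2 R p q) (SpRS R (2 ^ ((p + q - 5) %/ 2)) (2 ^ ((p + q - 5) %/ 2)))) /\
    ((p + q) %% 8 \in [:: 1; 7] ->
       lie_iso (G2 R p q) (OH R (2 ^ ((p + q - 3) %/ 2)))) /\
    (((p == 0) || (q == 0)) && ~~ odd (p + q) ->
       lie_iso (G2 R p q) (dupG (SpH R (2 ^ ((p + q - 4) %/ 2))))) /\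
    (((p + q) %% 8 == 4) && (p != 0) && (q != 0) ->
       lie_iso (G2 R p q) (dupG (SpRS R (2 ^ ((p + q - 6) %/ 2)) (2 ^ ((p + q - 6) %/ 2))))) /\
    ((p + q) %% 8 == 0 ->
       lie_iso (G2 R p q) (dupG (OH R (2 ^ ((p + q - 4) %/ 2))))) /\
    ((p + q) %% 8 \in [:: 2; 6] ->
       lie_iso (G2 R p q) (GLH R (2 ^ ((p + q - 4) %/ 2))))).
Proof.
move=> n0; split; [|split; [|split; [|split]]].
- exact: (classify_full (t := false) (h := false) n0 (G23_TG R p q)).
- exact: (classify_full (t := false) (h := true) n0 (G12_TG R p q)).
- exact: (classify_full (t := true) (h := true) n0 (G2i1_TG R p q)).
- exact: (classify_full (t := true) (h := false) n0 (G2i3_TG R p q)).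
- exact: (classify_even n0 (G2_TG R p q)).
Qed.
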